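(* Fix $\beta>0$. There exist positive constants $c_1$ and $C$ depending only on $\beta$ such that, for every Erlang-C model with arrival rate $\lambda>0$, service rate $\mu>0$ and $n$ servers satisfying $n=R+\beta\sqrt{R}$, where $R=\lambda/\mu$, $$\left|\frac{\mathbb{P}(Y_1\ge z)}{\mathbb{P}(W\ge z)}-1\right|\le \frac{C}{\sqrt R}\left(1+\frac{z}{\sqrt R}\right)\quad\text{for } 0<z\le c_1R,$$ and $$\left|\frac{\mathbb{P}(Y_1\le -z)}{\mathbb{P}(W\le -z)}-1\right|\le \frac{C}{\sqrt R}\left(1+z+\frac{z^4}{\sqrt R}\right)\quad\text{for } 0<z\le \min\{c_1R^{1/4},R^{1/2}\}.$$
   Context: Erlang-C ($M/M/n$) model: $\lambda,\mu>0$, $n$ is a positive integer, $R=\lambda/\mu<n$, $\delta=1/\sqrt{R}$, $\beta=\delta(n-R)>0$ (so $n=R+\beta\sqrt R$). $X=\{X(t),t\ge 0\}$ is the birth-death continuous-time Markov chain on $\{0,1,2,\dots\}$ with birth rate $\lambda$ and death rate $\mu\min(k,n)$ in state $k$; it is positive recurrent. $W$ is a random variable having the stationary distribution of $\delta(X(t)-R)$. Let $b(x)=-\min(\mu x,\mu\beta)$ and $a(x)=2\mu-\delta\, b(\max(x,-\sqrt R))$ for $x\in\mathbb{R}$, and $v_1(x)=\frac12 a(x)$. $Y_1$ is a random variable on $\mathbb{R}$ with density $\frac{\kappa}{v_1(x)}\exp\big(\int_0^x \frac{b(y)}{v_1(y)}\,dy\big)$, where $\kappa>0$ is the normalizing constant.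 *)

(* Defs.v *)
From HB Require Import structures.
From mathcomp Require Import all_boot all_order all_algebra.
From mathcomp Require Import all_classical all_reals all_analysis.
Set Implicit Arguments.
Unset Strict Implicit.
Unset Printing Implicit Defensive.
Import Order.TTheory GRing.Theory Num.Theory.
Import numFieldNormedType.Exports.
Local Open Scope classical_set_scope.
Local Open Scope ring_scope.

Section ErlangC.
Context {R : realType}.
Implicit Types (lambda mu beta : R) (n : nat).

(** Conservative Q-matrix of the number of customers in an M/M/n queue. *)
Definition erlangC_rate lambda mu n (i j : nat) : R :=
  let birth := lambda in
  let death := mu * (minn i n)%:R in
  if j == i.+1 then birth
  else if i == j.+1 then death
  else if i == j then - (birth + death)
  else 0.

(** A continuous-time Markov chain on [nat] is given by its transition
    function: [p t i] is the law of [X(t)] given [X(0) = i].  Since [p] is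
    indexed by all of [R], every condition is restricted to times [t >= 0]. *)
Definition transition_function (p : R -> R.-pker nat ~> nat) : Prop :=
  (forall i : nat, p 0 i [set i] = 1%E) /\
  (forall (s t : R) (i : nat) (A : set nat), 0 <= s -> 0 <= t ->
     p (s + t) i A = (\int[p s i]_j p t j A)%E).

(** [P(X(h) = j | X(0) = i) = (i == j) + q i j * h + o(h)] as [h] tends to
    [0] from the right. *)
Definition has_rates (p : R -> R.-pker nat ~> nat) (q : nat -> nat -> R) : Prop :=
  forall i j : nat,
    (fine (p h i [set j]) - (i == j)%:R) / h @[h --> 0^'+] --> q i j.

(** The rates are bounded, so they determine [p t] for all [t >= 0]. *)
Definition erlangC_chain lambda mu n (p : R -> R.-pker nat ~> nat) : Prop :=
  transition_function p /\ has_rates p (erlangC_rate lambda mu n).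

Definition stationary (p : R -> R.-pker nat ~> nat) (pi : probability nat R) : Prop :=
  forall (t : R) (A : set nat), 0 <= t -> (\int[pi]_i p t i A)%E = pi A.

Definition load lambda mu : R := lambda / mu.

Definition delta lambda mu : R := (Num.sqrt (load lambda mu))^-1.

Definition scaled_state lambda mu (k : nat) : R :=
  delta lambda mu * (k%:R - load lambda mu).

Definition drift mu beta (x : R) : R := - Num.min (mu * x) (mu * beta).

Definition diffusion lambda mu beta (x : R) : R :=
  2 * mu - delta lambda mu *
    drift mu beta (Num.max x (- Num.sqrt (load lambda mu))).

Definition v1 lambda mu beta (x : R) : R := 2^-1 * diffusion lambda mu beta x.

(** Oriented integral from [0] to [x], for [x] of either sign. *)
Definition integral0 (f : R -> R) (x : R) : R :=
  if 0 <= x then \int[lebesgue_measure]_(y in `[0, x]) f y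
  else - \int[lebesgue_measure]_(y in `[x, 0]) f y.

Definition Y1_density lambda mu beta (kappa x : R) : R :=
  kappa / v1 lambda mu beta x *
  expR (integral0 (fun y => drift mu beta y / v1 lambda mu beta y) x).

Definition has_density d (T : measurableType d) (P : probability T R)
    (Y : {RV P >-> R}) (f : R -> R) : Prop :=
  forall A : set R, measurable A ->
    distribution P Y A = (\int[lebesgue_measure]_(x in A) (f x)%:E)%E.

End ErlangC.

(* Main.v *)
Require Import Defs.
From HB Require Import structures.
From mathcomp Require Import all_boot all_order all_algebra.
From mathcomp Require Import all_classical all_reals all_analysis.
From mathcomp Require Import measurable_realfun.
From mathcomp Require Import ring lra.
Set Implicit Arguments.
Unset Strict Implicit.
Unset Printing Implicit Defensive.
Import Order.TTheory GRing.Theory Num.Theory.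
Import numFieldNormedType.Exports.
Local Open Scope classical_set_scope.
Local Open Scope ring_scope.

(** Both tails are compared through explicit formulas.  Bounding the exit
    probabilities linearly in time turns the infinitesimal rates into the
    detailed balance equations by dominated convergence, so the law of [W] is
    Poisson-like below state [n] and geometric above.  On the lattice
    [x_k = (k - R) / sqrt R], write [u = x_k / sqrt R]; the log-increments of
    the Poisson weights are [ln (1 + u)], those of the density of [Y1] are
    [u / (1 + u / 2)] up to [O(1 / R)].  The two agree up to [O(u ^ 3)], so
    that, normalized at state [n], the law of [W] and the mass of [Y1] on a
    lattice cell agree up to the relative error
    [err = (1 + |x|) / sqrt R + x ^ 4 / R].  Summing this error against the
    weights, by a discrete Stein identity for the lower tail, gives the bounds
    below [beta]; above [beta] an exponential tail is compared with a
    geometric one. *)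

(** * Detailed balance *)

(** The obstacle is uniformity: constants may depend on [beta] only. The time scale drops out,
    leaving [S = sqrt R] and [beta], and [n >= 1] forces [1 / S <= 1 + beta], so surplus powers of
    [1 / S] become constants. No normalizing constant is computed. Both laws are compared with the
    same explicit weights, and having mass 1 they are scaled alike up to [O(1 / S)]. The
    state-dependent [v1] is what makes the log-increments agree to third order: a constant
    coefficient would leave [u] against [ln (1 + u)], a quadratic error. Cubic errors over about
    [S * |x|] cells add up to [x ^ 4 / R]. Far to the left this fails: Poisson increments are
    unbounded and [Y1] charges [(-oo, - S)], where the queue has no states. But there [x ^ 4 / R] is
    bounded below, so mere boundedness of the ratios suffices. Upper tails starting at or below
    [beta] have mass bounded below, so absolute errors are enough. A lower tail can be arbitrarily
    small and its error must be weighed against its own mass; this is why moments over a tail have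
    to be controlled by its end point. *)

Lemma bernoulli_ineq (R : realType) (x : R) (m : nat) :
  0 <= x <= 1 -> 1 - m%:R * x <= (1 - x) ^+ m.
Proof.
move=> /andP[x0 x1]; elim: m => [|m IH]; first by rewrite expr0; lra.
rewrite exprS; have := ler_wpM2l (_ : 0 <= 1 - x) IH.
move=> /(_ ltac:(lra)); apply: le_trans.
have m0 : 0 <= m%:R :> R by [].
rewrite -natr1; nra.
Qed.

Section Balance.
Context {R : realType}.
Variables (lambda mu : R) (n : nat).
Hypotheses (lambda0 : 0 < lambda) (mu0 : 0 < mu).
Variables (p : R -> R.-pker nat ~> nat).
Hypothesis chain : erlangC_chain lambda mu n p.

Definition trans_prob (i : nat) (A : set nat) (h : R) := fine (p h i A).
Local Notation f := trans_prob.

Lemma kernel_trans_prob h i A : p h i A = (f i A h)%:E.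
Proof.
rewrite /trans_prob fineK// ge0_fin_numE//.
have : (p h i A <= p h i setT)%E by apply: le_measure; rewrite ?inE.
by rewrite prob_kernel => /le_lt_trans; apply; rewrite ltry.
Qed.

Lemma trans_prob_bounds h i A : 0 <= f i A h <= 1.
Proof.
rewrite -!lee_fin -kernel_trans_prob measure_ge0/=.
have : (p h i A <= p h i setT)%E by apply: le_measure; rewrite ?inE.
by rewrite prob_kernel.
Qed.

(** Chapman-Kolmogorov, keeping only the intermediate state [i]. *)
Lemma trans_prob_supermul s t i : 0 <= s -> 0 <= t ->
  f i [set i] s * f i [set i] t <= f i [set i] (s + t).
Proof.
move=> s0 t0; rewrite -lee_fin -kernel_trans_prob (chain.1.2 s t i [set i] s0 t0).
have -> : (f i [set i] s * f i [set i] t)%:E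
   = (\int[p s i]_(j in [set i]) (f i [set i] t)%:E)%E.
  by rewrite integral_cst//= kernel_trans_prob EFinM muleC.
rewrite [leLHS](_ : _ = (\int[p s i]_(j in [set i]) p t j [set i])%E); last first.
  by apply: eq_integral => j; rewrite inE /= => ->; rewrite kernel_trans_prob.
by apply: ge0_subset_integral => //.
Qed.

Lemma trans_prob_exp h i m : 0 <= h -> f i [set i] h ^+ m <= f i [set i] (h *+ m).
Proof.
move=> h0; elim: m => [|m IH].
  by rewrite expr0 mulr0n -lee_fin -kernel_trans_prob (chain.1.1 i).
rewrite exprS mulrS; apply: le_trans (trans_prob_supermul _ _ _) => //; last exact: mulrn_wge0.
by apply: ler_wpM2l => //; case/andP: (trans_prob_bounds h i [set i]).
Qed.

(** The rate at time [0] gives this only for small times and up to an error. Cutting [[0, h]] into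
    [m] short steps and keeping the chain at [i] at each grid time, supermultiplicativity and
    Bernoulli's inequality extend it to every [h > 0]. *)
Lemma holding_lower h i : 0 < h ->
  1 - (lambda + mu * (minn i n)%:R) * h <= f i [set i] h.
Proof.
move=> h0; apply/ler_addgt0Pr => e e0.
set q := lambda + mu * (minn i n)%:R.
have q0 : 0 < q by rewrite ltr_wpDr// mulr_ge0// ltW.
have := chain.2 i i.
have -> : erlangC_rate lambda mu n i i = - q.
  by rewrite /erlangC_rate (ltn_eqF (ltnSn i)) eqxx.
move=> /cvgrPdist_lt /(_ (e / h)); rewrite divr_gt0// => /(_ isT).
move=> [d /= d0 Hd].
(* [m] makes the step [h / m] shorter than [d], where the rate estimate holds, and keeps
   [(q + e / h) * (h / m)] below 1, as Bernoulli's inequality requires. *)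
pose m := (Num.truncn (Num.max (h / d) ((q + e / h) * h))).+1.
have mgt : Num.max (h / d) ((q + e / h) * h) < m%:R by rewrite /m truncnS_gt.
move: mgt; rewrite gt_max => /andP[m1 m2].
have m0 : 0 < m%:R :> R by rewrite ltr0n.
have hm0 : 0 < h / m%:R by rewrite divr_gt0.
have /Hd : ball_ (fun x => `|x|) 0 d (h / m%:R).
  rewrite /ball_/= sub0r normrN gtr0_norm// ltr_pdivrMr// mulrC -ltr_pdivrMr//.
move=> /(_ hm0); rewrite eqxx /= -/(f _ _ _) => Hf.
set t := h / m%:R in hm0 Hf *.
have Hft : 1 - (q + e / h) * t <= f i [set i] t.
  move: Hf; rewrite ltr_norml => /andP[_]; rewrite -subr_lt0.
  set F := f _ _ _ => Hf.
  have -> : F = 1 + (F - 1) / t * t by rewrite divfK ?gt_eqF// addrC subrK.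
  nra.
have eh0 : 0 < e / h by rewrite divr_gt0.
have tm : t *+ m = h by rewrite -mulr_natr /t divfK// gt_eqF.
have mt : m%:R * t = h by rewrite mulrC mulr_natr tm.
have Hx : 0 <= (q + e / h) * t <= 1.
  apply/andP; split; first by rewrite mulr_ge0//; lra.
  by rewrite /t mulrA ler_pdivrMr// mul1r ltW.
have := bernoulli_ineq m Hx.
rewrite mulrCA mt mulrDl divfK ?gt_eqF// => B.
have := trans_prob_exp i m (ltW hm0); rewrite tm => Fm.
have : (1 - (q + e / h) * t) ^+ m <= f i [set i] t ^+ m.
  by rewrite lerXn2r// nnegrE; [lra|case/andP: (trans_prob_bounds t i [set i])].
lra.
Qed.

(** Rates between states of [{0, ..., k}] cancel within a row; only the flow across the edge from
    [k] to [k.+1] survives. Testing stationarity on [{0, ..., k}] thus gives the cut equation at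
    once. *)
Lemma rate_partial_sum i k :
  \sum_(j < k.+1) erlangC_rate lambda mu n i j =
  (i == k.+1)%:R * (mu * (minn i n)%:R) - (i == k)%:R * lambda.
Proof.
have rateE j : erlangC_rate lambda mu n i j = (j == i.+1)%:R * lambda
    + (i == j.+1)%:R * (mu * (minn i n)%:R)
    - (i == j)%:R * (lambda + mu * (minn i n)%:R).
  rewrite /erlangC_rate; case: (eqVneq j i.+1) => [->|_].
    by rewrite (ltn_eqF (ltnSn i)) (@ltn_eqF i i.+2)//=; ring.
  case: (eqVneq i j.+1) => [->|_].
    by rewrite (gtn_eqF (ltnSn j)) /=; ring.
  by case: (eqVneq i j) => _ /=; ring.
elim: k => [|k IH].
  rewrite big_ord1 rateE/=; case: i {rateE} => [|i] /=; last by rewrite eqSS; ring.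
  by rewrite min0n; ring.
rewrite big_ord_recr/= IH rateE eqSS (eq_sym k i); ring.
Qed.

Lemma trans_prob_sum h i k : f i `I_k h = \sum_(j < k) f i [set (j : nat)] h.
Proof.
apply: EFin_inj; rewrite -kernel_trans_prob -sumEFin.
elim: k => [|k IH]; first by rewrite big_ord0 II0 measure0.
rewrite big_ord_recr/= -IH -kernel_trans_prob -measureU//; first by rewrite IIS.
by apply/seteqP; split => // j [/= jk jE]; rewrite jE ltnn in jk.
Qed.

Variable (pi : probability nat R).
Hypothesis stat : stationary p pi.

(** [g] is the difference quotient in time of the probability of [{0, ..., k}]. Its [pi]-mean is
    zero by stationarity, and the mean of its pointwise limit [gl] is the difference of the two
    sides. *)
Lemma detailed_balance k :
  lambda * fine (pi [set k]) = mu * (minn k.+1 n)%:R * fine (pi [set k.+1]).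
Proof.
pose M := lambda + mu * n%:R.
pose h (m : nat) : R := m.+1%:R^-1.
have h0 m : 0 < h m by rewrite invr_gt0.
pose g m i := ((f i `I_k.+1 (h m) - (i < k.+1)%N%:R) / h m)%:E : \bar R.
pose gl i := ((i == k.+1)%:R * (mu * (minn i n)%:R) - (i == k)%:R * lambda)%:E : \bar R.
have gcvg i : g ^~ i @ \oo --> gl i.
  apply: cvg_EFin; first exact: nearW.
  rewrite -rate_partial_sum.
  have -> : fine \o g ^~ i = fun m =>
     \sum_(j < k.+1) (f i [set (j : nat)] (h m) - (i == j)%:R) / h m.
    apply/funext => m /=; rewrite trans_prob_sum -mulr_suml; congr (_ / _).
    rewrite sumrB; congr (_ - _).
    elim: (k.+1) => [|k' IH']; first by rewrite big_ord0.
    by rewrite big_ord_recr/= -IH' ltnS leq_eqVlt -natrD; case: ltngtP.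
  apply: cvg_big => [|j _]; first exact: add_continuous.
  have /cvg_at_rightP := chain.2 i j; apply.
  by split => //; exact: cvg_harmonic.
(* Up to sign the quotient is the probability of leaving or of entering [{0, ..., k}], divided by
   [h m]. Either event requires leaving [i], so [holding_lower] bounds it by [M], which dominates
   every total rate. *)
have gM m i : (`|g m i| <= M%:E)%E.
  rewrite /g abse_EFin lee_fin normrM (gtr0_norm (_ : 0 < (h m)^-1)) ?invr_gt0//.
  rewrite ler_pdivrMr//.
  have := holding_lower i (h0 m).
  have qM : lambda + mu * (minn i n)%:R <= M.
    by rewrite lerD2l ler_pM2l// ler_nat geq_minr.
  have := trans_prob_bounds (h m) i `I_k.+1; move=> /andP[A1 A2].
  have hm0 := h0 m => H.
  have {}H : 1 - M * h m <= f i [set i] (h m).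
    by apply: le_trans H; rewrite lerD2l lerN2 ler_pM2r.
  case: ltnP => ik /=.
    rewrite distrC ger0_norm ?subr_ge0//.
    have : f i [set i] (h m) <= f i `I_k.+1 (h m).
      by rewrite -lee_fin -!kernel_trans_prob le_measure ?inE// => j ->.
    lra.
  rewrite subr0 ger0_norm//.
  have : f i [set i] (h m) + f i `I_k.+1 (h m) <= 1.
    rewrite -lee_fin EFinD -!kernel_trans_prob -measureU//.
      by have := trans_prob_bounds (h m) i (i |` `I_k.+1); rewrite -!lee_fin -kernel_trans_prob => /andP[].
    by apply/seteqP; split => // j [/= ->]; rewrite leqNgt ltnS ik.
  lra.
have [|||||_ _ +] := @dominated_convergence _ _ _ pi setT measurableT g gl (cst M%:E).
- by move=> m.
- by [].
- by apply: aeW => i _; exact: gcvg.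
- by apply: finite_measure_integrable_cst.
- by apply: aeW => i m _; exact: gM.
have bint (u : nat -> R) (B : R) : (forall i, `|u i| <= B) ->
    pi.-integrable setT (EFin \o u).
  move=> uB; apply: (@le_integrable _ _ _ pi setT measurableT _ (cst B%:E)) => //.
    by move=> i _ /=; rewrite lee_fin (le_trans (uB i))// ler_norm.
  exact: finite_measure_integrable_cst.
have bindic A : pi.-integrable setT (EFin \o (\1_A : nat -> R)).
  by apply: (bint _ 1) => i; rewrite indicE; case: (i \in A); rewrite ?normr1 ?normr0.
have -> : (fun m => \int[pi]_i g m i)%E = cst 0%E.
  apply/funext => m /=.
  have -> : g m = fun i => ((h m)^-1%:E * ((EFin \o (f ^~ `I_k.+1) ^~ (h m)) i - (EFin \o \1_(`I_k.+1)) i))%E.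
    apply/funext => i; rewrite /g /= -EFinB -EFinM mulrC indicE.
    by congr ((_ * (_ - (nat_of_bool _)%:R))%:E); apply/idP/idP; rewrite inE.
  have fint : pi.-integrable setT (EFin \o (f ^~ `I_k.+1) ^~ (h m)).
    by apply: (bint _ 1) => i; case/andP: (trans_prob_bounds (h m) i `I_k.+1) => a0 a1; rewrite ger0_norm.
  rewrite integralZl//; last exact: integrableB.
  rewrite integralB//= integral_indic// setIT.
  under eq_integral do rewrite -kernel_trans_prob.
  by rewrite stat ?(ltW (h0 m))// subee ?mule0// fin_num_measure.
have -> : (\int[pi]_i gl i)%E = (mu * (minn k.+1 n)%:R * fine (pi [set k.+1]) - lambda * fine (pi [set k]))%:E.
  have -> : gl = fun i => ((mu * (minn k.+1 n)%:R)%:E * (EFin \o \1_[set k.+1]) i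
      - lambda%:E * (EFin \o \1_[set k]) i)%E.
    apply/funext => i; rewrite /gl /= -!EFinM -EFinB !indicE.
    have E (a b : nat) : (a \in [set b]) = (a == b) by apply/idP/eqP; rewrite inE.
    by rewrite !E; case: (eqVneq i k.+1) => [->|_] /=; congr EFin; ring.
  rewrite integralB//; [|exact: integrableZl..].
  rewrite !integralZl// !integral_indic// !setIT EFinB !EFinM.
  by rewrite !fineK// fin_num_measure.
move=> /cvg_lim -/(_ (@ereal_hausdorff _)); rewrite lim_cst// => -[] H.
by apply/esym/eqP; rewrite -subr_eq0 -H.
Qed.
End Balance.

(** * The density of the diffusion approximation *)

Local Open Scope ring_scope.

Section OrientedIntegral.
Context {R : realType}.
Notation leb := (@lebesgue_measure R).

Lemma continuous_integrable_itv (f : R -> R) (a b : R) : continuous f ->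
  leb.-integrable `[a, b] (EFin \o f).
Proof.
move=> cf; apply: continuous_compact_integrable; first exact: segment_compact.
exact: continuous_subspaceT.
Qed.

Lemma Rintegral_chasles (f : R -> R) (a x b : R) : continuous f ->
  a <= x -> x <= b ->
  \int[leb]_(t in `[a, b]) f t =
  \int[leb]_(t in `[a, x]) f t + \int[leb]_(t in `[x, b]) f t.
Proof.
move=> cf ax xb.
have := @Rintegral_itvB R f (BLeft a) (BRight b) x (continuous_integrable_itv _ _ cf).
rewrite !bnd_simp => /(_ ax xb) H.
apply/eqP; rewrite addrC -subr_eq H; apply/eqP/Rintegral_itv_obnd_cbnd.
apply: integrableS (continuous_integrable_itv x b cf) => //.
exact: subset_itv_oc_cc.
Qed.

Lemma integral0B (f : R -> R) (a b : R) : continuous f -> a <= b ->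
  Defs.integral0 f b - Defs.integral0 f a = \int[leb]_(t in `[a, b]) f t.
Proof.
move=> cf ab; rewrite /Defs.integral0.
case: (leP 0 a) => a0; first by rewrite (le_trans a0 ab) (Rintegral_chasles cf a0 ab); ring.
case: (leP 0 b) => b0; first by rewrite opprK (Rintegral_chasles cf (ltW a0) b0) addrC.
by rewrite (Rintegral_chasles cf ab (ltW b0)); ring.
Qed.

Lemma Rintegral_itv_bounds (f : R -> R) (a b m M : R) : continuous f -> a <= b ->
  (forall x, a <= x <= b -> m <= f x <= M) ->
  m * (b - a) <= \int[leb]_(t in `[a, b]) f t <= M * (b - a).
Proof.
move=> cf ab fmM.
have E (r : R) : r * (b - a) = \int[leb]_(t in `[a, b]) r.
  rewrite Rintegral_cst//= lebesgue_measure_itv/= lte_fin.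
  by case: ltgtP ab => // -> _; rewrite subrr.
have icst (r : R) : leb.-integrable `[a, b] (EFin \o cst r).
  by apply: continuous_integrable_itv; exact: cst_continuous.
rewrite !E; apply/andP; split; apply: le_Rintegral => //;
  try exact: continuous_integrable_itv; try exact: icst;
  by move=> x /=; rewrite in_itv/= => /fmM /andP[].
Qed.

End OrientedIntegral.

Lemma continuous_maxr (R : realType) (f g : R -> R) (x : R) :
  {for x, continuous f} -> {for x, continuous g} ->
  {for x, continuous (fun x => Num.max (f x) (g x))}.
Proof.
move=> cf cg; have -> : (fun x => Num.max (f x) (g x)) =
    (fun x => (f x + g x + `|f x - g x|) / 2).
  by apply/funext => y; rewrite maxr_absE.
apply: continuousM; last exact: cst_continuous.
apply: continuousD; first exact: continuousD.
apply: (@continuous_comp _ _ _ (fun x => f x - g x) (fun x => `|x|)).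
  exact: continuousB.
exact: norm_continuous.
Qed.

Lemma continuous_minr (R : realType) (f g : R -> R) (x : R) :
  {for x, continuous f} -> {for x, continuous g} ->
  {for x, continuous (fun x => Num.min (f x) (g x))}.
Proof.
move=> cf cg; have -> : (fun x => Num.min (f x) (g x)) =
    (fun x => - Num.max (- f x) (- g x)).
  by apply/funext => y; rewrite oppr_max !opprK.
by apply: continuousN; apply: continuous_maxr; exact: continuousN.
Qed.

(** * Drift ratio and potential of the rescaled diffusion *)

Section DriftRatio.
Context {R : realType}.
Variables (S beta : R).
Hypotheses (S0 : 0 < S) (b0 : 0 < beta).

(** With [S] for the square root of the load, [rvol] is [v1 / mu] and [rdrift] is [- drift / v1];
    the sign makes [rdrift] nondecreasing. *)
Definition rvol (x : R) : R := 1 + Num.min (Num.max x (- S)) beta / (2 * S).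
Definition rdrift (x : R) : R := Num.min x beta / rvol x.

Lemma opp_le_beta : - S <= beta. Proof. by move: (S0) (b0) => S1 b1; lra. Qed.

Lemma rvol_mono (x y : R) : x <= y -> rvol x <= rvol y.
Proof.
move: (S0) (b0) => S1 b1.
move=> xy; rewrite lerD2l ler_pM2r ?invr_gt0 ?mulr_gt0//.
by rewrite le_min !ge_min lexx orbT andbT ge_max !le_max xy lexx orbT.
Qed.

Lemma rvol_low (x : R) : x <= - S -> rvol x = 2^-1.
Proof.
move: (S0) (b0) => S1 b1.
move=> xS; rewrite /rvol max_r// min_l ?opp_le_beta//.
by field; lra.
Qed.

Lemma rvol_mid (x : R) : - S <= x <= beta -> rvol x = 1 + x / (2 * S).
Proof. by move=> /andP[Sx xb]; rewrite /rvol max_l// min_l. Qed.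

Lemma rvol_high (x : R) : beta <= x -> rvol x = 1 + beta / (2 * S).
Proof. by move=> bx; rewrite /rvol max_l ?min_r// (le_trans opp_le_beta). Qed.

Lemma rvol_ge (x : R) : 2^-1 <= rvol x.
Proof.
move: (S0) (b0) => S1 b1.
rewrite -(rvol_low (lexx (-S))); case: (leP (-S) x) => Sx; first exact: rvol_mono.
by rewrite !rvol_low// ltW.
Qed.

Lemma rvol_gt0 (x : R) : 0 < rvol x.
Proof. by apply: lt_le_trans (rvol_ge x). Qed.

Lemma rdrift_low (x : R) : x <= - S -> rdrift x = 2 * x.
Proof.
move: (S0) (b0) => S1 b1.
move=> xS; rewrite /rdrift rvol_low// min_l; first by field.
exact: le_trans xS opp_le_beta.
Qed.

Lemma rdrift_mid (x : R) : - S <= x <= beta -> rdrift x = x / (1 + x / (2 * S)).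
Proof. by move=> xS; rewrite /rdrift rvol_mid// min_l//; case/andP: xS. Qed.

Lemma rdrift_high (x : R) : beta <= x -> rdrift x = beta / (1 + beta / (2 * S)).
Proof. by move=> xS; rewrite /rdrift rvol_high// min_r. Qed.

(** The difference equals [y - x] over the product of the two values of [rvol], each at least
    1/2. *)
Lemma rdrift_mid_diff (x y : R) : - S <= x -> x <= y -> y <= beta ->
  0 <= rdrift y - rdrift x <= 4 * (y - x).
Proof.
move: (S0) (b0) => S1 b1.
move=> Sx xy yb.
have hx : - S <= x <= beta by apply/andP; split => //; lra.
have hy : - S <= y <= beta by apply/andP; split => //; lra.
have vx := rvol_ge x; have vy := rvol_ge y.
have vx0 := rvol_gt0 x; have vy0 := rvol_gt0 y.
rewrite !rdrift_mid//; move: vx vy vx0 vy0; rewrite !rvol_mid//.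
set X := 1 + x / _; set Y := 1 + y / _ => vx vy vx0 vy0.
have -> : y / Y - x / X = (y - x) * (X^-1 * Y^-1).
  have -> : x / X = (x * Y) * (X^-1 * Y^-1) by field; rewrite !gt_eqF.
  have -> : y / Y = (y * X) * (X^-1 * Y^-1) by field; rewrite !gt_eqF.
  by rewrite -mulrBl /X /Y; congr (_ * _); field; lra.
have X2 : 0 < X^-1 <= 2 by rewrite invr_gt0 vx0 -[leRHS]invrK lef_pV2// ?posrE.
have Y2 : 0 < Y^-1 <= 2 by rewrite invr_gt0 vy0 -[leRHS]invrK lef_pV2// ?posrE.
move: X2 Y2; set a := X^-1; set b := Y^-1 => /andP[a0 a2] /andP[c0 c2].
have ab0 : 0 <= a * b by nra.
have ab4 : a * b <= 4 by nra.
by apply/andP; split; nra.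
Qed.

Lemma rdrift_mono (x y : R) : x <= y -> rdrift x <= rdrift y.
Proof.
move: (S0) (b0) => S1 b1.
have low (x' y' : R) : x' <= y' -> y' <= - S -> rdrift x' <= rdrift y'.
  by move=> xy yS; rewrite !rdrift_low//; lra.
have mid (x' y' : R) : - S <= x' -> x' <= y' -> y' <= beta -> rdrift x' <= rdrift y'.
  by move=> Sx xy yb; have /andP[+ _] := rdrift_mid_diff Sx xy yb; rewrite subr_ge0.
have high (x' y' : R) : beta <= x' -> x' <= y' -> rdrift x' <= rdrift y'.
  by move=> bx xy; rewrite !rdrift_high// (le_trans bx).
have mh (x' y' : R) : - S <= x' -> x' <= y' -> rdrift x' <= rdrift y'.
  move=> Sx xy; case: (leP y' beta) => yb; first exact: mid.
  case: (leP beta x') => bx; first exact: high.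
  by apply: le_trans (mid x' beta _ _ _) (high _ _ _ (ltW yb)) => //; exact: ltW.
move=> xy; case: (leP y (-S)) => yS; first exact: low.
case: (leP (-S) x) => Sx; first exact: mh.
by apply: le_trans (low x (-S) (ltW Sx) (lexx _)) (mh _ _ (lexx _) (ltW yS)).
Qed.

Lemma rvol_continuous : continuous rvol.
Proof.
move: (S0) (b0) => S1 b1.
move=> x; have clip : {for x, continuous (fun x => Num.min (Num.max x (- S)) beta)}.
  by apply: continuous_minr; [apply: continuous_maxr|exact: cst_continuous];
    [exact: cvg_id|exact: cst_continuous].
by apply: cvgD; [exact: cvg_cst|apply: cvgM; [exact: clip|exact: cvg_cst]].
Qed.

Lemma rdrift_continuous : continuous rdrift.
Proof.
move: (S0) (b0) => S1 b1.
move=> x; have clip : {for x, continuous (fun x => Num.min x beta)}.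
  by apply: continuous_minr; [exact: cvg_id|exact: cst_continuous].
apply: cvgM; first exact: clip.
by apply: cvgV; [rewrite gt_eqF ?rvol_gt0|exact: rvol_continuous].
Qed.

Definition potential (x : R) : R := Defs.integral0 (fun y => - rdrift y) x.

Lemma potential0 : potential 0 = 0.
Proof. by rewrite /potential /Defs.integral0 lexx set_itv1 Rintegral_set1. Qed.

(** Monotonicity of [rdrift] traps the increment between the two endpoint slopes. Later estimates of
    [potential], including its continuity, go through this inequality rather than through a closed
    form. *)
Lemma potential_slope (a b : R) : a <= b ->
  (b - a) * rdrift a <= potential a - potential b <= (b - a) * rdrift b.
Proof.
move: (S0) (b0) => S1 b1.
move=> ab.
have cN : continuous (fun y => - rdrift y).
  by move=> x; apply: cvgN; exact: rdrift_continuous.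
have := @Rintegral_itv_bounds _ _ a b (- rdrift b) (- rdrift a) cN ab.
case/(_ _)/andP; first by move=> x /andP[ax xb]; rewrite !lerN2 !rdrift_mono.
rewrite -integral0B// -/(potential a) -/(potential b) => H1 H2.
by apply/andP; split; lra.
Qed.

End DriftRatio.

Lemma integral_expR_tail (R : realType) (A c a : R) : 0 <= A -> 0 < c ->
  (\int[lebesgue_measure]_(x in `[a, +oo[) (A * expR (- c * (x - a)))%:E = (A / c)%:E)%E.
Proof.
move=> A0 c0.
pose F (x : R) := - (A / c) * expR (- c * (x - a)).
have dF (x : R) : is_derive x 1 F (A * expR (- c * (x - a))).
  rewrite /F; apply: is_derive_eq.
  by rewrite /GRing.scale/= ; field; rewrite gt_eqF.
have cf : continuous (fun x => A * expR (- c * (x - a))).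
  move=> x; apply: cvgM; first exact: cvg_cst.
  apply: continuous_comp; last exact: continuous_expR.
  apply: cvgM; first exact: cvg_cst.
  by apply: cvgB; [exact: cvg_id|exact: cvg_cst].
have cF : continuous F.
  move=> x; apply: differentiable_continuous; apply/derivable1_diffP.
  by case: (dF x).
rewrite (@ge0_continuous_FTC2y R _ F a 0).
- by rewrite /F subrr mulr0 expR0 mulr1 -EFinB sub0r opprK.
- by move=> x _; rewrite mulr_ge0// expR_ge0.
- exact: continuous_subspaceT.
- rewrite /F -[X in _ --> X](mulr0 (- (A / c))); apply: cvgM; first exact: cvg_cst.
  have to_oo : c * (x - a) @[x --> +oo] --> +oo.
    apply/cvgryPge => M; near=> x.
    have : M / c + a <= x by near: x; apply: nbhs_pinfty_ge; exact: num_real.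
    by rewrite -lerBrDr ler_pdivrMr// mulrC.
  have -> : (fun x => expR (- c * (x - a))) = (fun y => expR (- y)) \o (fun x => c * (x - a)).
    by apply/funext => x /=; rewrite mulNr.
  exact: cvg_comp to_oo (@cvgr_expR R).
- by move=> x _; case: (dF x).
- by apply: cvg_at_right_filter; exact: cF.
- by move=> x _; rewrite derive1E; case: (dF x) => _ ->.
Unshelve. all: end_near. Qed.

Section StationaryDensity.
Context {R : realType}.
Variables (S beta k : R).
Hypotheses (S0 : 0 < S) (b0 : 0 < beta) (k0 : 0 < k).
Notation rvol := (rvol S beta).
Notation rdrift := (rdrift S beta).
Notation potential := (potential S beta).

Definition dens (x : R) : R := k / rvol x * expR (potential x).

Lemma potential_continuous : continuous potential.
Proof.
suff close (x e : R) : 0 < e -> \forall y \near x, `|potential x - potential y| <= e.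
  by move=> x; apply/cvgrPdist_le => e e0; exact: close.
move=> e0; pose B : R := `|rdrift (x - 1)| + `|rdrift (x + 1)| + 1.
have B1 : 0 < B by rewrite ltr_wpDl// addr_ge0.
near=> y.
have xy : `|x - y| <= Num.min 1 (e / B).
  by near: y; apply: cvgr_dist_le; [exact: cvg_id|rewrite lt_min ltr01 divr_gt0].
have [xy1 xy2] : `|x - y| <= 1 /\ `|x - y| <= e / B by move: xy; rewrite le_min => /andP[].
have H (a b : R) : a <= b -> x - 1 <= a -> b <= x + 1 -> `|a - b| * B <= e ->
    `|potential a - potential b| <= e.
  move=> ab xa xb abe.
  have /andP[s1 s2] := potential_slope S0 b0 ab.
  have m1 := rdrift_mono S0 b0 xa; have m2 := rdrift_mono S0 b0 xb.
  have n1 := ler_norm (- rdrift (x - 1)); have n2 := ler_norm (rdrift (x + 1)).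
  rewrite normrN in n1.
  have n3 := normr_ge0 (rdrift (x - 1)); have n4 := normr_ge0 (rdrift (x + 1)).
  move: abe; rewrite distrC ger0_norm ?subr_ge0// => abe.
  rewrite /B in abe.
  by rewrite ler_norml; apply/andP; split; nra.
move: xy2; rewrite ler_pdivlMr// => xy2.
have := xy1; rewrite ler_norml => /andP[l1 l2].
case: (leP x y) => xley; first by apply: H => //; lra.
by rewrite distrC; apply: H => //; rewrite 1?distrC//; lra.
Unshelve. all: end_near. Qed.

Lemma dens_continuous : continuous dens.
Proof.
move=> x; apply: cvgM.
  apply: cvgM; first exact: cvg_cst.
  by apply: cvgV; [rewrite gt_eqF ?rvol_gt0|exact: rvol_continuous].
by apply: continuous_comp; [exact: potential_continuous|exact: continuous_expR].
Qed.

Lemma dens_ge0 x : 0 <= dens x.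
Proof. by rewrite mulr_ge0 ?expR_ge0// divr_ge0 ?ltW// rvol_gt0. Qed.

Variable nu : probability R R.
Hypothesis nuE : forall A : set R, measurable A ->
  nu A = (\int[lebesgue_measure]_(x in A) (dens x)%:E)%E.

Lemma prob_itv_bounds (a b m M : R) : a <= b ->
  (forall x, a <= x <= b -> m <= dens x <= M) ->
  m * (b - a) <= fine (nu [set` `[a, b[]) <= M * (b - a).
Proof.
move=> ab mM.
have -> : fine (nu [set` `[a, b[]) = \int[lebesgue_measure]_(x in `[a, b]) dens x.
  rewrite nuE// -Rintegral_itv_bndo_bndc//.
  apply: integrableS (continuous_integrable_itv a b dens_continuous) => //.
  exact: subset_itv_co_cc.
exact: Rintegral_itv_bounds dens_continuous ab mM.
Qed.

(** Above [beta] the coefficients are constant, so the two slope bounds coincide and the density is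
    exactly exponential; [rvol] cancels between the density and its decay rate. *)
Lemma prob_upper_tail (z : R) : beta <= z ->
  fine (nu [set` `[z, +oo[]) = k / beta * expR (potential beta)
    * expR (- (beta / (1 + beta / (2 * S))) * (z - beta)).
Proof.
move=> bz; set th := beta / _.
have den0 : 0 < 1 + beta / (2 * S) by rewrite addr_gt0// divr_gt0// mulr_gt0.
have th0 : 0 < th by rewrite divr_gt0.
have pot (x : R) : beta <= x -> potential x = potential beta - th * (x - beta).
  move=> bx; have := potential_slope S0 b0 bx.
  rewrite !rdrift_high// -/th => /andP[l1 l2]; have {l1 l2} : (x - beta) * th = potential beta - potential x.
    by apply/eqP; rewrite eq_le l1 l2.
  by move=> H; rewrite mulrC H; ring.
rewrite nuE//.
pose A := k / (1 + beta / (2 * S)) * expR (potential beta) * expR (- th * (z - beta)).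
have A0 : 0 <= A by rewrite !mulr_ge0 ?expR_ge0// ltW// invr_gt0.
rewrite (_ : (\int[_]_(x in _) _)%E = (A / th)%:E).
  by rewrite /= /A /th; move: den0 (expR _) => + E; set D := 1 + _ => D0; field; rewrite !gt_eqF.
rewrite -(integral_expR_tail z A0 th0); apply: eq_integral => x.
rewrite inE/= in_itv/= andbT => zx; congr EFin.
have bx := le_trans bz zx.
rewrite /dens rvol_high// pot// /A -[RHS]mulrA -[RHS]mulrA -!expRD.
by congr (_ * expR _); clearbody th; ring.
Qed.

(** Left of [- S] the slope is at least [2 * S] in absolute value, which gives an exponential
    majorant. The bound is the lattice spacing [1 / S] times [k * expR (potential (- S))], so this
    mass can be charged to state [0]. *)
Lemma prob_lower_tail : fine (nu [set` `]-oo, - S[]) <= k / S * expR (potential (- S)).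
Proof.
pose A := 2 * k * expR (potential (- S)).
have A0 : 0 <= A by rewrite !mulr_ge0 ?expR_ge0// ltW.
have c0 : 0 < 2 * S by rewrite mulr_gt0.
pose G (x : R) := A * expR (2 * S * (x + S)).
have densG (x : R) : x < - S -> dens x <= G x.
  move=> xS; rewrite /dens /G /A (rvol_low S0 b0 (ltW xS)) invrK (mulrC k) -(mulrA (2 * k)).
  rewrite ler_pM2l ?mulr_gt0// -expRD ler_expR.
  have /andP[_] := potential_slope S0 b0 (ltW xS); rewrite rdrift_low//; lra.
have cG : continuous G.
  move=> x; apply: cvgM; first exact: cvg_cst.
  apply: continuous_comp; last exact: continuous_expR.
  apply: cvgM; first exact: cvg_cst.
  by apply: cvgD; [exact: cvg_id|exact: cvg_cst].
have GE : (\int[lebesgue_measure]_(x in `]-oo, (- S)%R]) (G x)%:E = (A / (2 * S))%R%:E)%E.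
  rewrite ge0_integration_by_substitutionNy//.
  - rewrite -(integral_expR_tail S A0 c0); apply: eq_integral => x _ /=.
    by rewrite /G; congr (_ * expR _)%:E; ring.
  - exact: continuous_subspaceT.
  - by move=> x _; rewrite mulr_ge0// expR_ge0.
have -> : k / S * expR (potential (- S)) = A / (2 * S).
  by rewrite /A; field; rewrite gt_eqF.
rewrite -lee_fin fineK ?fin_num_measure// -GE nuE//.
apply: (@le_trans _ _ (\int[lebesgue_measure]_(x in `]-oo, (- S)%R[) (G x)%:E)%E).
  apply: ge0_le_integral.
  - exact: measurable_itv.
  - by move=> x _; rewrite lee_fin dens_ge0.
  - apply/measurable_EFinP; apply: measurable_funTS.
    exact: continuous_measurable_fun dens_continuous.
  - apply/measurable_EFinP; apply: measurable_funTS.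
    exact: continuous_measurable_fun cG.
  - by move=> x /= xS; rewrite lee_fin densG//; move: xS; rewrite in_itv.
apply: ge0_subset_integral.
- exact: measurable_itv.
- exact: measurable_itv.
- apply/measurable_EFinP; apply: measurable_funTS.
  exact: continuous_measurable_fun cG.
- by move=> x _; rewrite lee_fin mulr_ge0// expR_ge0.
- by move=> x /=; rewrite !in_itv/= => /ltW.
Qed.

End StationaryDensity.

(** * Elementary bounds *)

Section ElementaryBounds.
Context {R : realType}.
Implicit Types (a A t u x y : R).

(* [2 (t - 1) / (t + 1)] is the second-order accurate Pade approximation of
   [ln t]; the error has derivative [(t - 1)^2 / (t (t + 1)^2)]. *)
Definition ln_gap t : R := ln t - 2 * (t - 1) / (t + 1).

Lemma ln_gap_MVT (s t : R) : 0 < s -> s < t ->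
  exists2 c, s < c < t &
    ln_gap t - ln_gap s = (c - 1) ^+ 2 / (c * (c + 1) ^+ 2) * (t - s).
Proof.
move=> s0 st.
have dgap (c : R) : 0 < c -> is_derive c 1 ln_gap ((c - 1) ^+ 2 / (c * (c + 1) ^+ 2)).
  move=> c0; have ? := is_derive1_ln c0.
  have c1 : c + 1 != 0 by rewrite gt_eqF// addr_gt0.
  rewrite /ln_gap.
  have d1 : is_derive c 1 (fun x : R => x + 1) 1 by apply: is_derive_eq; rewrite addr0.
  have dV := @is_deriveV R (fun x : R => x + 1) c 1 1 c1 d1.
  apply: is_derive_eq.
  by rewrite /GRing.scale/=; field; rewrite c1 gt_eqF.
have [c||c] := @MVT R ln_gap (fun c => (c - 1) ^+ 2 / (c * (c + 1) ^+ 2)) s t st.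
- by rewrite in_itv/= => /andP[sc _]; apply: dgap; exact: lt_trans sc.
- apply: derivable_within_continuous => c; rewrite in_itv/= => /andP[sc _].
  by case: (dgap c (lt_le_trans s0 sc)).
by rewrite in_itv/=; exists c.
Qed.

Lemma ln_gap1 : ln_gap 1 = 0.
Proof. by rewrite /ln_gap ln1 subrr mulr0 mul0r subrr. Qed.

Lemma ln_gap_le0 (t : R) : 0 < t <= 1 -> ln_gap t <= 0.
Proof.
move=> /andP[t0]; rewrite le_eqVlt => /predU1P[->|t1]; first by rewrite ln_gap1.
have [c /andP[tc c1]] := ln_gap_MVT t0 t1; rewrite ln_gap1 => H.
have c0 : 0 < c := lt_trans t0 tc.
have : 0 <= (c - 1) ^+ 2 / (c * (c + 1) ^+ 2) * (1 - t).
  apply: mulr_ge0; last by rewrite subr_ge0 ltW.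
  by rewrite divr_ge0 ?sqr_ge0// mulr_ge0 ?sqr_ge0// ltW.
by rewrite -H; lra.
Qed.

Lemma ln_gap_deriv_bound (c : R) : 2^-1 <= c ->
  0 <= (c - 1) ^+ 2 / (c * (c + 1) ^+ 2) <= (c - 1) ^+ 2.
Proof.
move=> c2; have c0 : 0 < c by lra.
have D0 : 1 <= c * (c + 1) ^+ 2 by rewrite expr2; nra.
apply/andP; split.
  by rewrite divr_ge0 ?sqr_ge0// (le_trans _ D0).
by rewrite ler_pdivrMr ?(lt_le_trans _ D0)// ler_peMr// sqr_ge0.
Qed.

Lemma ln_gap_ge (t : R) : 2^-1 <= t <= 1 -> - (1 - t) ^+ 3 <= ln_gap t.
Proof.
move=> /andP[t0]; rewrite le_eqVlt => /predU1P[->|t1].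
  by rewrite ln_gap1 subrr expr0n oppr0.
have tp : 0 < t by lra.
have [c /andP[tc c1]] := ln_gap_MVT tp t1; rewrite ln_gap1 => H.
have /andP[g0 g1] : 0 <= (c - 1) ^+ 2 / (c * (c + 1) ^+ 2) <= (c - 1) ^+ 2.
  by apply: ln_gap_deriv_bound; lra.
move: g0 g1 H; set g := _ / _ => g0 g1 H.
have : (c - 1) ^+ 2 <= (1 - t) ^+ 2 by rewrite !expr2; nra.
move=> ct; have : g * (1 - t) <= (1 - t) ^+ 2 * (1 - t) by apply: ler_wpM2r; lra.
by rewrite -exprSr; lra.
Qed.

Lemma ln_gap_le (t : R) : 1 <= t -> 0 <= ln_gap t <= (t - 1) ^+ 3.
Proof.
rewrite le_eqVlt => /predU1P[<-|t1].
  by rewrite ln_gap1 subrr expr0n lexx.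
have [c /andP[tc c1]] := ln_gap_MVT ltr01 t1; rewrite ln_gap1 subr0 => H.
have /andP[g0 g1] : 0 <= (c - 1) ^+ 2 / (c * (c + 1) ^+ 2) <= (c - 1) ^+ 2.
  by apply: ln_gap_deriv_bound; lra.
move: g0 g1 H; set g := _ / _ => g0 g1 H; rewrite H.
have : (c - 1) ^+ 2 <= (t - 1) ^+ 2 by rewrite !expr2; nra.
move=> ct; have : g * (t - 1) <= (t - 1) ^+ 2 * (t - 1) by apply: ler_wpM2r; lra.
rewrite -exprSr => ->; rewrite andbT; apply: mulr_ge0 => //; lra.
Qed.

Lemma expR_sub1_le (a A : R) : a <= A -> 0 <= A -> `|expR a - 1| <= `|a| * expR A.
Proof.
move=> aA A0; case: (leP 0 a) => a0.
  rewrite (ger0_norm a0) ger0_norm; last by rewrite subr_ge0 -expR0 ler_expR.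
  have := expR_ge1Dx (- a); rewrite expRN => H.
  have e0 := expR_gt0 a.
  have : expR a * (1 - a) <= 1.
    by rewrite mulrC -ler_pdivlMr// mul1r.
  have : a * expR a <= a * expR A by rewrite ler_wpM2l// ler_expR.
  lra.
rewrite (ltr0_norm a0) ler0_norm; last by rewrite subr_le0 -expR0 ler_expR ltW.
have := expR_ge1Dx a.
have : 1 <= expR A by rewrite -expR0 ler_expR.
nra.
Qed.

Lemma expR_ge_pow4 (y : R) : 0 <= y -> y ^+ 4 <= 8 ^+ 4 * expR (y / 2).
Proof.
move=> y0; have -> : y / 2 = 4%:R * (y / 8) by field.
rewrite expRM_natl -exprMn; have := expR_ge1Dx (y / 8); set e := expR _ => He.
by apply: lerXn2r; rewrite ?nnegrE; lra.
Qed.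

End ElementaryBounds.

(** * Lattice weights *)

Section LatticeComparison.
Context {R : realType}.
Implicit Types (beta S kp : R) (n k : nat).

Definition lattice S k : R := k%:R / S - S.
Definition lpot beta S k : R := potential S beta (lattice S k).
Definition err S (x : R) : R := (1 + `|x|) / S + x ^+ 4 / S ^+ 2.

Definition regime beta S n := [/\ 0 < beta, 0 < S, (0 < n)%N & n%:R = S ^+ 2 + beta * S].

(** Having at least one server keeps [S] away from [0]. *)
Lemma regime_invS beta S n : regime beta S n -> S^-1 <= 1 + beta.
Proof.
move=> [b0 S0 n0 nE]; have : 1 <= n%:R :> R by rewrite ler1n.
rewrite nE expr2 => H.
case: (leP 1 S) => S1.
  have : S^-1 <= 1 by rewrite invf_le1.
  lra.
have : S^-1 <= S + beta by rewrite -[leLHS]mul1r ler_pdivrMr//; lra.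
lra.
Qed.

Lemma latticeS S k : 0 < S -> lattice S k.+1 = lattice S k + S^-1.
Proof. by move=> S0; rewrite /lattice -natr1; field; rewrite gt_eqF. Qed.

Lemma lattice_n beta S n : regime beta S n -> lattice S n = beta.
Proof. by move=> [b0 S0 n0 nE]; rewrite /lattice nE; field; rewrite gt_eqF. Qed.

Lemma lattice_mono S k l : 0 < S -> (k <= l)%N -> lattice S k <= lattice S l.
Proof. by move=> S0 kl; rewrite lerD2r ler_pM2r ?invr_gt0// ler_nat. Qed.

Lemma lattice_ge S k : 0 < S -> - S <= lattice S k.
Proof. by move=> S0; rewrite -[leLHS]add0r lerD2r divr_ge0// ltW. Qed.

Lemma lattice_range beta S n k : regime beta S n -> (k <= n)%N ->
  - S <= lattice S k <= beta.
Proof.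
move=> r kn; have [b0 S0 n0 nE] := r.
by rewrite lattice_ge//= -(lattice_n r) lattice_mono.
Qed.

Lemma lattice_sub beta S n k : regime beta S n -> (k <= n)%N ->
  (n - k)%:R = S * (beta - lattice S k).
Proof.
move=> r kn; have [b0 S0 n0 nE] := r.
by rewrite natrB// nE /lattice; field; rewrite gt_eqF.
Qed.

Lemma err_ge0 S x : 0 < S -> 0 <= err S x.
Proof.
move=> S0; rewrite addr_ge0//; first by rewrite divr_ge0 ?addr_ge0// ltW.
by rewrite divr_ge0 ?exprn_even_ge0// ltW.
Qed.

(** [ln t] is the log-ratio of the queue weights at [k] and [k.+1], and [t = 1 + y / S] for the
    right end [y] of the cell. The rational part of [ln_gap t] is exactly [rdrift y / S], cell
    length times right-end slope. It cancels against the increment of the potential up to [1 / S]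
    times the variation of [rdrift] over the cell, which is at most [4 / S]. *)
Lemma lpot_step beta S n k : regime beta S n -> (k < n)%N ->
  let t := k.+1%:R / S ^+ 2 in
  ln_gap t <= ln t + (lpot beta S k.+1 - lpot beta S k) <= ln_gap t + 4 / S ^+ 2.
Proof.
move=> r kn /=; set t := _ / S ^+ 2; have [b0 S0 n0 nE] := r.
set x := lattice S k; set y := lattice S k.+1.
have yE : y = x + S^-1 by exact: latticeS.
have iS : 0 < S^-1 by rewrite invr_gt0.
have /andP[Sx xb] : - S <= x <= beta by apply: lattice_range r _; exact: ltnW.
have /andP[Sy yb] : - S <= y <= beta by exact: lattice_range r _.
have xy : x <= y by rewrite yE; lra.
have := potential_slope S0 b0 xy.
have -> : y - x = S^-1 by rewrite yE; ring.
rewrite -/(lpot beta S k) -/(lpot beta S k.+1) => /andP[l1 l2].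
have /andP[_ l3] := rdrift_mid_diff S0 b0 Sx xy yb.
have t0 : 0 < t by rewrite divr_gt0// exprn_gt0.
have tE : t = 1 + y / S by rewrite /t /y /lattice; field; rewrite gt_eqF.
have qE : 2 * (t - 1) / (t + 1) = S^-1 * rdrift S beta y.
  rewrite rdrift_mid//; last by rewrite Sy.
  have v0 : 1 + y / (2 * S) != 0.
    by rewrite -(@rvol_mid _ _ beta) ?Sy// gt_eqF// rvol_gt0.
  have v1 : t + 1 != 0 by rewrite gt_eqF// addr_gt0.
  have v2 : 2 * S + y != 0.
    apply: contra_neq v0 => H; have -> : 1 + y / (2 * S) = (2 * S + y) / (2 * S) by field; rewrite gt_eqF.
    by rewrite H mul0r.
  by rewrite tE; field; rewrite v2 gt_eqF//=; apply: contra_neq v2 => <-; ring.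
have S2 : 4 / S ^+ 2 = S^-1 * (4 * S^-1) by field; rewrite gt_eqF.
have l3' : rdrift S beta y - rdrift S beta x <= 4 * S^-1.
  by move: l3; rewrite yE; have -> : x + S^-1 - x = S^-1 by ring.
have := ler_wpM2l (ltW iS) l3'.
rewrite mulrBr -S2 /ln_gap qE => l4.
by apply/andP; split; lra.
Qed.


Definition log_ratio beta S n k : R :=
  \sum_(k <= j < n) (ln (j.+1%:R / S ^+ 2) + (lpot beta S j.+1 - lpot beta S j)).

Lemma log_ratioE beta S n (q : nat -> R) k : regime beta S n ->
  (forall j, (j < n)%N -> q j = j.+1%:R / S ^+ 2 * q j.+1) -> (k <= n)%N ->
  q k = q n * expR (lpot beta S k - lpot beta S n + log_ratio beta S n k).
Proof.
move=> r rec /subnK; move: (n - k)%N => m; elim: m k => [|m IH] k kmn.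
  by rewrite -kmn add0n /log_ratio big_geq// subrr addr0 expR0 mulr1.
have [b0 S0 n0 nE] := r.
have kn : (k < n)%N by rewrite -kmn addSn ltnS leq_addl.
rewrite (rec k kn) (IH k.+1); last by rewrite addnS.
rewrite /log_ratio [in RHS]big_ltn// -/(log_ratio _ _ _ _).
set t := _ / S ^+ 2; have t0 : 0 < t by rewrite divr_gt0// exprn_gt0.
set L := log_ratio _ _ _ _.
have -> : lpot beta S k - lpot beta S n + (ln t + (lpot beta S k.+1 - lpot beta S k) + L)
  = ln t + (lpot beta S k.+1 - lpot beta S n + L) by ring.
by rewrite [in RHS]expRD lnK// mulrCA.
Qed.

(** Only terms with [t > 1] have a positive [ln_gap], and there [t - 1 <= beta / S], whose cube is
    at most a constant over [S ^+ 2]. Each of the [S * (beta - x)] terms is therefore bounded above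
    by a constant over [S ^+ 2], however far to the left. *)
Lemma log_ratio_le beta S n k : regime beta S n -> (k <= n)%N ->
  log_ratio beta S n k <=
    (4 + (1 + beta) ^+ 4) * (beta - lattice S k) / S.
Proof.
move=> r kn; have [b0 S0 n0 nE] := r.
set K := 4 + _.
suff term j : (j < n)%N ->
    ln (j.+1%:R / S ^+ 2) + (lpot beta S j.+1 - lpot beta S j) <= K / S ^+ 2.
  have -> : K * (beta - lattice S k) / S = \sum_(k <= j < n) (K / S ^+ 2).
    by rewrite sumr_const_nat -mulr_natr (lattice_sub r kn); field; rewrite gt_eqF.
  by apply: ler_sum_nat => j /andP[_ jn]; exact: term.
move=> jn; have /andP[_] := lpot_step r jn; set t := _ / S ^+ 2 => /le_trans; apply.
have t0 : 0 < t by rewrite divr_gt0// exprn_gt0.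
have S2 : 0 < (S ^+ 2)^-1 by rewrite invr_gt0 exprn_gt0.
set B := 1 + beta in K *.
have -> : K / S ^+ 2 = 4 / S ^+ 2 + B ^+ 4 / S ^+ 2 by rewrite -mulrDl.
rewrite addrC lerD2l.
have B4 : 0 <= B ^+ 4 / S ^+ 2 by rewrite mulr_ge0// ?exprn_ge0 ?ltW// addr_gt0.
case: (leP t 1) => t1; first by apply: le_trans B4; apply: ln_gap_le0; rewrite t0.
have /andP[_ /le_trans] := ln_gap_le (ltW t1); apply.
have tE : t - 1 = lattice S j.+1 / S by rewrite /t /lattice; field; rewrite gt_eqF.
have /andP[_ yb] := lattice_range r jn.
have iS0 : 0 < S^-1 by rewrite invr_gt0.
have tb : t - 1 <= beta * S^-1 by rewrite tE ler_pM2r.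
have : (t - 1) ^+ 3 <= (beta * S^-1) ^+ 3.
  by apply: lerXn2r; rewrite ?nnegrE//; [lra|rewrite mulr_ge0// ltW].
move=> /le_trans; apply.
have iSB := regime_invS r; rewrite -/B in iSB.
have B1 : beta <= B by rewrite /B; lra.
have -> : (beta * S^-1) ^+ 3 = (beta ^+ 3 * S^-1) * (S ^+ 2)^-1 by field; rewrite gt_eqF.
rewrite ler_pM2r//; have -> : B ^+ 4 = B ^+ 3 * B by rewrite exprSr.
have B0 : 0 <= B by lra.
apply: ler_pM => //; [by rewrite exprn_ge0// ltW|exact: ltW|].
by apply: lerXn2r; rewrite ?nnegrE//; lra.
Qed.

(** Near [t = 0] the logarithm is unbounded below; the restriction on [x] gives [t >= 1/2] on all
    cells from [k] on. Each term is then at least minus the cube of [|x| / S], and there are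
    [S * (beta - x)] of them. *)
Lemma log_ratio_ge beta S n k : regime beta S n -> (k <= n)%N ->
  - (S / 2) <= lattice S k ->
  - ((beta + `|lattice S k|) * `|lattice S k| ^+ 3 / S ^+ 2) <= log_ratio beta S n k.
Proof.
move=> r kn Sk; have [b0 S0 n0 nE] := r.
set x := lattice S k in Sk *.
have iS0 : 0 < S^-1 by rewrite invr_gt0.
have L0 : 0 <= (`|x| / S) ^+ 3 by rewrite exprn_ge0// mulr_ge0// ltW.
suff term j : (k <= j)%N -> (j < n)%N ->
    - (`|x| / S) ^+ 3 <= ln (j.+1%:R / S ^+ 2) + (lpot beta S j.+1 - lpot beta S j).
  apply: (@le_trans _ _ (\sum_(k <= j < n) - (`|x| / S) ^+ 3)); last first.
    by apply: ler_sum_nat => j /andP[kj jn]; exact: term.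
  rewrite sumr_const_nat -mulr_natr (lattice_sub r kn) -/x mulNr lerN2.
  have -> : (`|x| / S) ^+ 3 * (S * (beta - x)) = (beta - x) * (`|x| ^+ 3 / S ^+ 2).
    by field; rewrite gt_eqF.
  rewrite -mulrA ler_wpM2r//; first by rewrite divr_ge0// exprn_ge0// ltW.
  by rewrite lerD2l -normrN ler_norm.
move=> kj jn; have /andP[+ _] := lpot_step r jn; set t := _ / S ^+ 2; apply: le_trans.
have t0 : 0 < t by rewrite divr_gt0// exprn_gt0.
have tE : t - 1 = lattice S j.+1 / S by rewrite /t /lattice; field; rewrite gt_eqF.
have xy : x <= lattice S j.+1 by apply: lattice_mono => //; exact: leq_trans kj _.
have xt : x / S <= t - 1 by rewrite tE ler_pM2r.
have xS : - 2^-1 <= x / S by rewrite ler_pdivlMr//; lra.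
case: (leP t 1) => t1.
  apply: le_trans (ln_gap_ge _); last by apply/andP; split; lra.
  rewrite lerN2; apply: lerXn2r; rewrite ?nnegrE; first by lra.
    by rewrite mulr_ge0// ltW.
  have : - (`|x| / S) <= x / S.
    by rewrite -mulNr ler_pM2r// lerNl -normrN ler_norm.
  lra.
by have /andP[+ _] := ln_gap_le (ltW t1); apply: le_trans; rewrite oppr_le0.
Qed.

(** Here [x ^+ 4 / S ^+ 2 >= S ^+ 2 / 16], and [S] is bounded below. *)
Lemma err_ge_deep beta S n x : regime beta S n -> x <= - (S / 2) ->
  (16 * (1 + beta) ^+ 2)^-1 <= err S x.
Proof.
move=> r xS; have [b0 S0 n0 nE] := r.
have iS0 : 0 < S^-1 by rewrite invr_gt0.
have iSB := regime_invS r; set B := 1 + beta in iSB *.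
have B0 : 0 < B by rewrite addr_gt0.
apply: (@le_trans _ _ (x ^+ 4 / S ^+ 2)); last first.
  by rewrite lerDr divr_ge0 ?addr_ge0// ltW.
have x2 : (S / 2) ^+ 2 <= x ^+ 2.
  by rewrite -[x ^+ 2]sqrrN; apply: lerXn2r; rewrite ?nnegrE; lra.
have x4 : ((S / 2) ^+ 2) ^+ 2 <= (x ^+ 2) ^+ 2.
  by apply: lerXn2r; rewrite ?nnegrE ?sqr_ge0.
rewrite ler_pdivlMr ?exprn_gt0//.
have -> : x ^+ 4 = (x ^+ 2) ^+ 2 by rewrite -exprM.
apply: le_trans x4.
have -> : ((S / 2) ^+ 2) ^+ 2 = (S ^+ 2 / 16) * S ^+ 2 by field.
rewrite ler_pM2r ?exprn_gt0// invfM mulrC ler_pM2r ?invr_gt0//.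
rewrite -exprVn; apply: lerXn2r; rewrite ?nnegrE ?invr_ge0; [exact: ltW..|].
by rewrite invf_ple ?posrE.
Qed.

Lemma weight_comparison beta : 0 < beta -> exists2 K : R, 0 < K &
  forall S n, regime beta S n -> forall k, (k <= n)%N ->
  `|expR (log_ratio beta S n k) - 1| <= K * err S (lattice S k).
Proof.
move=> b0; pose B := 1 + beta; pose K1 := 4 + B ^+ 4.
have B1 : 1 < B by rewrite /B; lra.
have B0 : 0 < B by lra.
have K10 : 0 < K1 by rewrite /K1 addr_gt0// exprn_gt0.
(* A bound on [log_ratio] valid for every [k], since [(beta - x) / S <= 1 + beta / S <= B ^+ 2]. *)
pose A := K1 * B ^+ 2.
have A0 : 0 <= A by rewrite mulr_ge0 ?ltW// exprn_gt0.
pose K2 := expR A; have K20 : 0 < K2 := expR_gt0 _.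
exists ((K1 * B + B ^+ 2 + 16 * B ^+ 2) * K2).
  by rewrite mulr_gt0// !addr_gt0 ?mulr_gt0 ?exprn_gt0.
move=> S n r k kn; have [_ S0 n0 nE] := r.
have iS0 : 0 < S^-1 by rewrite invr_gt0.
have iSB := regime_invS r; rewrite -/B in iSB.
have /andP[Sx xb] := lattice_range r kn.
have := log_ratio_le r kn; rewrite -/B -/K1.
set x := lattice S k in Sx xb *; set a := log_ratio _ _ _ _ => aK.
have e0 : 0 <= err S x := err_ge0 x S0.
have nx : `|x| - x >= 0 by rewrite subr_ge0 ler_norm.
have nx' : - x <= `|x| by rewrite -normrN ler_norm.
have n0' : 0 <= `|x| by [].
have aA : a <= A.
  apply: le_trans aK _; rewrite /A -mulrA ler_pM2l//.
  rewrite ler_pdivrMr// expr2.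
  have : 1 <= S * B by rewrite mulrC -ler_pdivrMr// div1r.
  by rewrite /B in B1 *; nra.
have H := expR_sub1_le aA A0; rewrite -/K2 in H.
have x40 : 0 <= x ^+ 4 / S ^+ 2 by rewrite divr_ge0 ?exprn_even_ge0// ltW// exprn_gt0.
have exE : (1 + `|x|) / S <= err S x by rewrite lerDl.
have aU : a <= (K1 * B) * err S x.
  apply: le_trans aK _; apply: (@le_trans _ _ (K1 * B * ((1 + `|x|) / S))).
    rewrite -!mulrA ler_pM2l// !mulrA ler_pM2r// /B; nra.
  by rewrite ler_pM2l// mulr_gt0.
(* Right of [- (S / 2)] both one-sided bounds on [a] apply. Left of it, [a <= A] alone gives
   [|expR a - 1| <= K2], and [err] is at least a constant. *)
case: (leP (- (S / 2)) x) => xS.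
  apply: le_trans H _; rewrite mulrAC ler_pM2r//.
  have aL := log_ratio_ge r kn xS; rewrite -/x -/a in aL.
  have aL' : - (B ^+ 2 * err S x) <= a.
    apply: le_trans aL; rewrite lerN2.
    have x4 : x ^+ 4 = `|x| ^+ 4 by rewrite -normrX ger0_norm// exprn_even_ge0.
    have x3 : `|x| ^+ 3 <= 1 + `|x| ^+ 4.
      case: (leP `|x| 1) => x1.
        have : `|x| ^+ 3 <= 1 by rewrite exprn_ile1.
        have : 0 <= `|x| ^+ 4 by rewrite exprn_ge0.
        lra.
      have : `|x| ^+ 3 <= `|x| ^+ 4 by rewrite ler_eXn2l// ltW.
      lra.
    have H1 : (beta + `|x|) * `|x| ^+ 3 <= B * `|x| ^+ 4 + beta.
      by rewrite mulrDl -exprS /B; nra.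
    apply: (@le_trans _ _ ((B * `|x| ^+ 4 + beta) / S ^+ 2)).
      by rewrite ler_pM2r// invr_gt0 exprn_gt0.
    rewrite /err x4 mulrDr mulrDl addrC; apply: lerD.
      have -> : beta / S ^+ 2 = beta * (S^-1 * S^-1) by field; rewrite gt_eqF.
      apply: (@le_trans _ _ (B * (B * S^-1))).
        apply: ler_pM; [exact: ltW|by rewrite mulr_ge0// ltW|by rewrite /B; lra|].
        by rewrite ler_pM2r.
      rewrite mulrA -expr2 ler_pM2l ?exprn_gt0// ler_pMl//; lra.
    rewrite -mulrA ler_wpM2r//; last by rewrite expr2; nra.
    by rewrite -x4.
  rewrite ler_norml; apply/andP; split.
    rewrite lerNl; apply: (@le_trans _ _ (B ^+ 2 * err S x)); first by rewrite lerNl.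
    by rewrite ler_wpM2r// -addrA addrCA lerDl addr_ge0// !mulr_ge0 ?exprn_ge0 ?ltW.
  apply: le_trans aU _; rewrite ler_wpM2r// -addrA lerDl addr_ge0// ?mulr_ge0 ?exprn_ge0 ?ltW//.
have eK2 : expR a <= K2 by rewrite ler_expR.
have K21 : 1 <= K2 by rewrite -expR0 ler_expR.
have ea := expR_gt0 a.
have eL := err_ge_deep r (ltW xS); rewrite -/B in eL.
have D0 : 0 < 16 * B ^+ 2 by rewrite mulr_gt0// exprn_gt0.
apply: (@le_trans _ _ K2).
  by rewrite ler_norml; apply/andP; split; lra.
rewrite mulrAC -[leLHS]mul1r ler_pM2r//.
apply: (@le_trans _ _ (16 * B ^+ 2 * err S x)).
  by rewrite mulrC -ler_pdivrMr// div1r.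
by rewrite ler_wpM2r// lerDr addr_ge0 ?mulr_ge0 ?exprn_ge0 ?ltW.
Qed.

End LatticeComparison.

(** * Decay of the lattice weights and sums of [err] against them *)

Section Weights.
Context {R : realType}.
Implicit Types (beta S kp : R) (n k : nat).

Lemma potential_le0 beta S (x : R) : 0 < beta -> 0 < S -> potential S beta x <= 0.
Proof.
move=> b0 S0.
have d0 : rdrift S beta 0 = 0 by rewrite /rdrift min_l ?mul0r// ltW.
case: (leP 0 x) => x0.
  have /andP[+ _] := potential_slope S0 b0 x0.
  by rewrite d0 potential0 mulr0 sub0r oppr_ge0.
have /andP[_] := potential_slope S0 b0 (ltW x0).
by rewrite d0 potential0 mulr0 subr0.
Qed.

(** Left of [-1] the slope is at most [-1], because [rvol <= 1] at [-1]. Exponential decay already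
    beats the polynomial factor in [err]. *)
Lemma potential_le_linear beta S (x : R) : 0 < beta -> 0 < S ->
  potential S beta x <= 1 + x.
Proof.
move=> b0 S0; case: (leP (-1) x) => x1.
  by apply: le_trans (potential_le0 _ b0 S0) _; lra.
have /andP[_ H] := potential_slope S0 b0 (ltW x1).
have H0 := potential_le0 (-1) b0 S0.
have v1 : rvol S beta (-1) <= 1.
  have : rvol S beta (-1) <= rvol S beta 0 by apply: rvol_mono => //; lra.
  have -> // : rvol S beta 0 = 1.
  by rewrite rvol_mid ?mul0r ?addr0//; apply/andP; split; lra.
have v0 : 0 < rvol S beta (-1) by exact: rvol_gt0.
have d1 : rdrift S beta (-1) <= -1.
  rewrite /rdrift min_l; last by lra.
  by rewrite mulN1r lerN2 -[leLHS]invr1 lef_pV2 ?posrE.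
nra.
Qed.

Lemma potential_ge beta S (x : R) : 0 < beta -> 0 < S -> 0 <= x ->
  - (x * beta) <= potential S beta x.
Proof.
move=> b0 S0 x0; have /andP[_] := potential_slope S0 b0 x0.
have d1 : rdrift S beta x <= beta.
  have xb : x <= Num.max x beta by rewrite le_max lexx.
  apply: le_trans (rdrift_mono S0 b0 xb) _.
  rewrite rdrift_high ?le_max ?lexx ?orbT//.
  have p0 : 0 < beta / (2 * S) by rewrite divr_gt0 ?mulr_gt0.
  by rewrite ler_pdivrMr ?addr_gt0// ler_peMr ?ltW//; lra.
rewrite potential0; have := ler_wpM2l x0 d1; lra.
Qed.

(** A geometric sum is at most its next term divided by the ratio minus 1, here at least
    [1 / (2 * S)]. *)
Lemma sum_expR_lattice S m : 0 < S ->
  \sum_(0 <= j < m) expR (lattice S j / 2) <= 2 * S * expR (lattice S m / 2).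
Proof.
move=> S0; have S2 : 0 < 2 * S by rewrite mulr_gt0.
elim: m => [|m IH]; first by rewrite big_geq// mulr_ge0 ?expR_ge0 ?ltW.
rewrite big_nat_recr//= (latticeS _ S0).
have -> : (lattice S m + S^-1) / 2 = lattice S m / 2 + (2 * S)^-1.
  by field; rewrite gt_eqF.
rewrite expRD; have E := expR_ge1Dx (2 * S)^-1.
have e0 := expR_gt0 (lattice S m / 2).
move: IH E e0; set L := \sum_(_ <= _ < _) _; set e := expR (_ / 2); set f := expR _.
move=> IH E e0.
have : 2 * S * e * (1 + (2 * S)^-1) <= 2 * S * e * f.
  by rewrite ler_pM2l// mulr_gt0.
have -> : 2 * S * e * (1 + (2 * S)^-1) = 2 * S * e + e by field; rewrite gt_eqF.
by rewrite mulrA; lra.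
Qed.

(** Half of the decay [expR x] absorbs the polynomial in [err]; the other half is kept so that the
    sum over the lattice stays geometric. On [[0, beta]] everything is bounded. *)
Lemma err_weight_le beta : 0 < beta -> exists2 K : R, 0 < K &
  forall S n, regime beta S n -> forall k, (k <= n)%N ->
  S * err S (lattice S k) * expR (lpot beta S k) <= K * expR (lattice S k / 2).
Proof.
move=> b0; pose B := 1 + beta.
have B1 : 1 < B by rewrite /B; lra.
pose K1 := (1 + beta + B * beta ^+ 4) * expR (1 + beta).
pose K2 := (3 + B * 8 ^+ 4) * expR 1.
have K10 : 0 < K1.
  by rewrite mulr_gt0 ?expR_gt0// !addr_gt0// mulr_gt0 ?exprn_gt0//; lra.
have K20 : 0 < K2.
  by rewrite mulr_gt0 ?expR_gt0// addr_gt0// mulr_gt0 ?exprn_gt0//; lra.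
exists (K1 + K2); first by rewrite addr_gt0.
move=> S n r k kn; have [_ S0 n0 nE] := r.
have iSB := regime_invS r; rewrite -/B in iSB.
have /andP[Sx xb] := lattice_range r kn.
have := potential_le_linear (lattice S k) b0 S0.
rewrite /lpot; set x := lattice S k in Sx xb * => pL.
have x40 : 0 <= x ^+ 4 by rewrite exprn_even_ge0.
have errB : S * err S x <= 1 + `|x| + B * x ^+ 4.
  have -> : S * err S x = 1 + `|x| + S^-1 * x ^+ 4.
    by rewrite /err; field; rewrite gt_eqF.
  by rewrite lerD2l ler_wpM2r.
have e0 := expR_gt0 (x / 2).
have err0 : 0 <= 1 + `|x| + B * x ^+ 4.
  by rewrite !addr_ge0// mulr_ge0//; lra.
have pe : expR (potential S beta x) <= expR (1 + x) by rewrite ler_expR.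
apply: (@le_trans _ _ ((1 + `|x| + B * x ^+ 4) * expR (1 + x))).
  by apply: ler_pM; rewrite ?expR_ge0// mulr_ge0 ?err_ge0// ltW.
rewrite (mulrDl K1 K2); case: (leP 0 x) => x0.
  apply: (@le_trans _ _ (K1 * expR (x / 2))); last by rewrite lerDl mulr_ge0// ltW.
  apply: (@le_trans _ _ K1); last first.
    by rewrite ler_peMr ?(ltW K10)// -expR0 ler_expR divr_ge0.
  apply: ler_pM; rewrite ?expR_ge0//; last by rewrite ler_expR lerD2l.
  rewrite (ger0_norm x0); have : B * x ^+ 4 <= B * beta ^+ 4.
    apply: ler_wpM2l; first by lra.
    by apply: lerXn2r; rewrite ?nnegrE//; exact: ltW.
  lra.
apply: (@le_trans _ _ (K2 * expR (x / 2))); last by rewrite lerDr mulr_ge0// ltW.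
rewrite ltr0_norm//.
have H4 := @expR_ge_pow4 _ (- x) (ltac:(lra)).
have H1 := expR_ge1Dx (- x / 2).
have f1 : 1 <= expR (- x / 2) by lra.
have -> : expR (1 + x) = expR 1 * (expR (x / 2) * expR (x / 2)).
  by rewrite -!expRD; congr expR; field.
have fe : expR (- x / 2) * expR (x / 2) = 1.
  by rewrite -expRD -mulrDl addNr mul0r expR0.
have x4 : x ^+ 4 = (- x) ^+ 4 by ring.
rewrite x4; set f := expR (- x / 2) in H4 H1 f1 fe *.
have poly : 1 - x + B * (- x) ^+ 4 <= (3 + B * 8 ^+ 4) * f.
  rewrite (mulrDl 3) -mulrA; apply: lerD; last by rewrite ler_wpM2l//; lra.
  lra.
apply: le_trans (ler_wpM2r _ poly) _; first by rewrite !mulr_ge0 ?expR_ge0.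
rewrite /K2 -!mulrA ler_pM2l; last first.
  by rewrite addr_gt0// mulr_gt0 ?exprn_gt0//; lra.
by rewrite mulrCA [X in _ * X]mulrA fe mul1r.
Qed.

Lemma weight_sums beta : 0 < beta -> exists2 K : R, 0 < K &
  forall S n, regime beta S n ->
  \sum_(0 <= k < n) err S (lattice S k) * expR (lpot beta S k) <= K /\
  \sum_(0 <= k < n) expR (lpot beta S k) <= K * S.
Proof.
move=> b0; have [K K0 HK] := err_weight_le b0.
pose L := K * 2 * expR (beta / 2).
have L0 : 0 < L by rewrite !mulr_gt0// expR_gt0.
exists L => // S n r; have [_ S0 n0 nE] := r.
have sumS : \sum_(0 <= k < n) S * err S (lattice S k) * expR (lpot beta S k) <= L * S.
  apply: (@le_trans _ _ (\sum_(0 <= k < n) K * expR (lattice S k / 2))).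
    by apply: ler_sum_nat => k /andP[_ kn]; apply: HK r _ (ltnW kn).
  rewrite -mulr_sumr /L.
  have := sum_expR_lattice n S0; rewrite (lattice_n r) => H.
  by have := ler_wpM2l (ltW K0) H; rewrite !mulrA (mulrAC _ (expR _) S).
split.
  rewrite -(ler_pM2l S0) mulr_sumr (mulrC S L).
  by under eq_bigr do rewrite mulrA.
(* [S * err] is at least 1, so the plain sum of weights is below the sum just estimated. *)
apply: le_trans sumS; apply: ler_sum_nat => k _.
rewrite ler_peMl ?expR_ge0//.
have -> : S * err S (lattice S k) = 1 + `|lattice S k| + lattice S k ^+ 4 / S.
  by rewrite /err; field; rewrite gt_eqF.
by rewrite -addrA lerDl addr_ge0// divr_ge0 ?exprn_even_ge0// ltW.
Qed.

End Weights.

(** * Density over one cell, and discrete moments of a tail *)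

Section CellsAndMoments.
Context {R : realType}.
Implicit Types (beta S kp : R) (n k : nat).

Lemma rdrift_abs beta S (z : R) : 0 < beta -> 0 < S -> `|rdrift S beta z| <= 2 * `|z|.
Proof.
move=> b0 S0; have v2 := rvol_ge S0 b0 z; have v0 := rvol_gt0 S0 b0 z.
rewrite /rdrift normrM (gtr0_norm (_ : 0 < (rvol S beta z)^-1)) ?invr_gt0//.
rewrite ler_pdivrMr//.
have m : `|Num.min z beta| <= `|z|.
  case: (leP z beta) => // zb; rewrite !gtr0_norm//; first exact: ltW.
  exact: lt_trans b0 zb.
have z0 : 0 <= `|z| by [].
nra.
Qed.

Lemma lattice_abs beta S n k : regime beta S n -> (k <= n)%N ->
  `|lattice S k| / S <= (1 + beta) ^+ 2.
Proof.
move=> r kn; have [b0 S0 n0 nE] := r.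
have iSB := regime_invS r; have /andP[Sx xb] := lattice_range r kn.
have iS0 : 0 < S^-1 by rewrite invr_gt0.
have xS : `|lattice S k| <= S + beta.
  by rewrite ler_norml; apply/andP; split; lra.
apply: (@le_trans _ _ ((S + beta) / S)); first by rewrite ler_pM2r.
rewrite mulrDl divff ?gt_eqF// expr2.
nra.
Qed.

(** On a cell of width [1 / S] the exponent moves by at most the width times the slope bound
    [2 * (|x| + 1 / S)], and [rvol] differs from 1 by at most [|y| / (2 * S)]. Both are of order
    [(1 + |x|) / S]; [A] bounds them together. *)
Lemma dens_cell beta : 0 < beta -> exists2 K : R, 0 < K &
  forall S n, regime beta S n -> forall k kp (y : R), (k < n)%N -> 0 < kp ->
  lattice S k <= y <= lattice S k.+1 ->
  `|dens S beta kp y - kp * expR (lpot beta S k)|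
    <= K * err S (lattice S k) * (kp * expR (lpot beta S k)).
Proof.
move=> b0; pose B := 1 + beta.
have B1 : 1 < B by rewrite /B; lra.
pose E := expR (4 * B ^+ 2).
have E0 : 0 < E := expR_gt0 _.
exists (2 * B * (2 * E + 1)); first by rewrite !mulr_gt0//; lra.
move=> S n r k kp y kn kp0 /andP[xy yx]; have [_ S0 n0 nE] := r.
have iSB := regime_invS r; rewrite -/B in iSB.
have iS0 : 0 < S^-1 by rewrite invr_gt0.
have xS := lattice_abs r (ltnW kn); rewrite -/B in xS.
have /andP[Sx _] := lattice_range r (ltnW kn).
have /andP[_ xb] := lattice_range r kn.
rewrite latticeS// in yx xb; rewrite /lpot.
set x := lattice S k in xy yx xS Sx xb *.
have nx := ler_norm x; have nx' : - x <= `|x| by rewrite -normrN ler_norm.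
have n0' : 0 <= `|x| by [].
have yab : `|y| <= `|x| + S^-1 by rewrite ler_norml; apply/andP; split; lra.
pose A := 2 * (S^-1 * (`|x| + S^-1)).
have iS0' := ltW iS0; have A0 : 0 <= A by rewrite !mulr_ge0// addr_ge0.
have AA : A <= 4 * B ^+ 2.
  have -> : A = 2 * (`|x| / S + S^-1 * S^-1) by rewrite /A; ring.
  have : S^-1 * S^-1 <= B * B by apply: ler_pM.
  by rewrite -expr2; lra.
have Aerr : A <= 2 * B * err S x.
  apply: (@le_trans _ _ (2 * B * ((1 + `|x|) / S))).
    have -> : 2 * B * ((1 + `|x|) / S) = 2 * (S^-1 * (B * (1 + `|x|))) by ring.
    rewrite /A !ler_pM2l//.
    by rewrite /B in B1 iSB *; nra.
  rewrite ler_pM2l; last by rewrite mulr_gt0//; lra.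
  by rewrite lerDl divr_ge0 ?exprn_even_ge0// ltW// exprn_gt0.
have /andP[s1 s2] := potential_slope S0 b0 xy.
have hx := rdrift_abs x b0 S0; have hy := rdrift_abs y b0 S0.
set a := potential S beta y - potential S beta x.
have aA : `|a| <= A.
  have bnd (h : R) : `|h| <= 2 * (`|x| + S^-1) -> `|(y - x) * h| <= A.
    move=> hb; rewrite normrM /A mulrCA; apply: ler_pM => //.
    by rewrite ger0_norm; clear - xy yx; lra.
  have /bnd : `|rdrift S beta x| <= 2 * (`|x| + S^-1) by clear - hx iS0; lra.
  have /bnd : `|rdrift S beta y| <= 2 * (`|x| + S^-1) by clear - hy yab; lra.
  rewrite !ler_norml /a => /andP[l1 u1] /andP[l2 u2].
  by clear - s1 s2 l1 u1 l2 u2; apply/andP; split; lra.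
have vE : rvol S beta y = 1 + y / (2 * S) by apply: rvol_mid => //; clear - xy yx Sx xb; apply/andP; split; lra.
have v2 := rvol_ge S0 b0 y; have v0 := rvol_gt0 S0 b0 y.
set v := rvol S beta y in vE v2 v0.
have iv0 : 0 < v^-1 by rewrite invr_gt0.
have iv2 : v^-1 <= 2 by rewrite -[leRHS]invrK lef_pV2 ?posrE.
have v1 : `|v^-1 - 1| <= A.
  have -> : v^-1 - 1 = (1 - v) / v by rewrite mulrBl divff ?gt_eqF// mul1r.
  have -> : 1 - v = - (y / 2 * S^-1) by rewrite vE; field; rewrite gt_eqF.
  rewrite mulNr normrN normrM (gtr0_norm iv0) normrM (gtr0_norm iS0).
  have -> : A = ((`|x| + S^-1) * S^-1) * 2 by rewrite /A; ring.
  apply: ler_pM => //; [by rewrite mulr_ge0|exact: ltW|].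
  rewrite ler_pM2r// normrM (gtr0_norm (_ : 0 < 2^-1)) ?invr_gt0//.
  by have := normr_ge0 y; clear - yab; lra.
have ea : `|expR a - 1| <= A * E.
  have a4 : a <= 4 * B ^+ 2 by apply: le_trans AA; apply: le_trans aA; exact: ler_norm.
  apply: le_trans (expR_sub1_le a4 _) _; first by rewrite mulr_ge0 ?exprn_ge0//; lra.
  by rewrite ler_pM2r.
have key : `|expR a / v - 1| <= 2 * B * (2 * E + 1) * err S x.
  have -> : expR a / v - 1 = (expR a - 1) / v + (v^-1 - 1) by ring.
  apply: le_trans (ler_normD _ _) _.
  rewrite normrM (gtr0_norm iv0).
  apply: (@le_trans _ _ (A * E * 2 + A)).
    by apply: lerD => //; apply: ler_pM => //; exact: ltW.
  have -> : A * E * 2 + A = A * (2 * E + 1) by ring.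
  rewrite (mulrAC (2 * B)) ler_pM2r//; clear - E0; lra.
have -> : dens S beta kp y - kp * expR (potential S beta x)
    = (expR a / v - 1) * (kp * expR (potential S beta x)).
  rewrite /dens -/v; have -> : potential S beta y = a + potential S beta x.
    by rewrite /a subrK.
  by rewrite expRD; ring.
rewrite normrM (gtr0_norm (_ : 0 < kp * _)); last by rewrite mulr_gt0 ?expR_gt0.
by rewrite ler_pM2r// mulr_gt0 ?expR_gt0.
Qed.

(* Discrete form of the Stein identity for the standard normal law: [w] behaves
   like [exp (- y ^ 2 / 2)], so moments over a tail are governed by its
   boundary term [S * w k]. *)
Lemma tail_moments S (y w : nat -> R) k : 0 < S ->
  (forall j, y j = S - j%:R / S) -> 0 <= y k -> (forall j, 0 <= w j) ->
  (forall j, (j < k)%N -> y j.+1 * w j.+1 <= 2 * S * (w j.+1 - w j)) ->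
  (forall j, (j < k)%N -> S * (w j.+1 - w j) <= 2 * (y j.+1 + S^-1) * w j.+1) ->
  let M p := \sum_(0 <= j < k.+1) y j ^+ p * w j in
  [/\ S * w k <= 2 * M 1%N + 2 * S^-1 * M 0%N,
      M 2%N <= 2 * M 0%N + 2 * (y k * (S * w k)) &
      M 4%N <= 2 * (3 * M 2%N + 3 * S^-1 * M 1%N + S^-1 ^+ 2 * M 0%N + y k ^+ 3 * (S * w k))].
Proof.
move=> S0 yE yk0 w0; elim: k yk0 => [|k IH] yk0 lo up M.
  have y0 : y 0%N = S by rewrite yE mul0r subr0.
  rewrite /M !big_nat1 y0 !expr1 expr0 mul1r.
  have iS0 : 0 < S^-1 by rewrite invr_gt0.
  have Sd : S * S^-1 = 1 by rewrite divff// gt_eqF.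
  move: (w0 0%N) iS0 Sd; set u := w 0%N; set d := S^-1 => u0 d0 Sd.
  have Su : 0 <= S * u by rewrite mulr_ge0// ltW.
  have du : 0 <= d * u by rewrite mulr_ge0// ltW.
  have SSu : 0 <= S ^+ 2 * u by rewrite mulr_ge0// exprn_ge0// ltW.
  have ddu : 0 <= d ^+ 2 * u by rewrite mulr_ge0// exprn_ge0// ltW.
  have S4u : 0 <= S ^+ 4 * u by rewrite mulr_ge0// exprn_ge0// ltW.
  have dSu : d * (S * u) = u by rewrite mulrA (mulrC d) Sd mul1r.
  split; [by lra| |].
    have -> : S * (S * u) = S ^+ 2 * u by ring.
    lra.
  have -> : S ^+ 3 * (S * u) = S ^+ 4 * u by ring.
  have -> : 3 * d * (S * u) = 3 * u by rewrite -mulrA dSu.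
  lra.
have yS : y k = y k.+1 + S^-1 by rewrite !yE -natr1; ring.
have iS0 : 0 < S^-1 by rewrite invr_gt0.
have yk : 0 <= y k by rewrite yS; lra.
have [||I1 I2 I4] := IH yk _ _; [by move=> j jk; apply: lo; exact: ltnW| |].
  by move=> j jk; apply: up; exact: ltnW.
have ME p : M p = \sum_(0 <= j < k.+1) y j ^+ p * w j + y k.+1 ^+ p * w k.+1.
  by rewrite /M big_nat_recr.
move: I1 I2 I4 (lo k (ltnSn k)) (up k (ltnSn k)) (w0 k) (w0 k.+1).
rewrite !ME expr1 expr0 mul1r yS.
set M0 := \sum_(_ <= _ < _) _ ^+ 0 * _; set M1 := \sum_(_ <= _ < _) _ ^+ 1 * _.
set M2 := \sum_(_ <= _ < _) _ ^+ 2 * _; set M4 := \sum_(_ <= _ < _) _ ^+ 4 * _.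
move: yk0; set z := y k.+1; set u := w k; set v := w k.+1; set d := S^-1.
move=> z0 I1 I2 I4 lo' up' u0 v0.
have Sd : S * d = 1 by rewrite divff// gt_eqF.
have zv : 0 <= z * v by rewrite mulr_ge0.
have uv : u <= v by nra.
have dSu : d * (S * u) = u by rewrite mulrA (mulrC d) Sd mul1r.
have dv : 0 <= d * v by rewrite mulr_ge0// ltW.
split; first by lra.
  (* Summation by parts: [lo'] times [z] bounds the new term [z ^+ 2 * v] by the growth of the
     boundary term. Changing the factor of the old boundary term from [z + d] to [z] costs
     [d * (S * u) = u <= v], paid by the zeroth moment. *)
  have := ler_wpM2l z0 lo'.
  rewrite (mulrDl z) dSu in I2.
  lra.
have z3 : 0 <= z ^+ 3 by rewrite exprn_ge0.
have := ler_wpM2l z3 lo'.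
have E : (z + d) ^+ 3 * (S * u) = z ^+ 3 * (S * u)
    + (3 * z ^+ 2 + 3 * d * z + d ^+ 2) * (d * (S * u)) by ring.
rewrite E dSu in I4.
have c0 : 0 <= 3 * z ^+ 2 + 3 * d * z + d ^+ 2.
  by rewrite !addr_ge0// ?mulr_ge0// ?exprn_ge0// ltW.
have := ler_wpM2l c0 uv; lra.
Qed.

End CellsAndMoments.

(** * Error over a lower tail relative to its mass *)

Section TailErrors.
Context {R : realType}.
Implicit Types (beta S kp : R) (n k : nat).

Lemma expR_opp_le (t : R) : 0 <= t <= 1 -> expR (- t) <= 1 - t / 2.
Proof.
move=> /andP[t0 t1]; rewrite expRN.
have H := expR_ge1Dx t; have e0 := expR_gt0 t.
rewrite -[leLHS]mul1r ler_pdivrMr//; nra.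
Qed.

Lemma rdrift_le_id beta S (x : R) : 0 < beta -> 0 < S -> x <= 0 -> rdrift S beta x <= x.
Proof.
move=> b0 S0 x0.
have v0 := rvol_gt0 S0 b0 x.
have v1 : rvol S beta x <= 1.
  have -> : 1 = rvol S beta 0.
    by rewrite rvol_mid ?mul0r ?addr0//; apply/andP; split; lra.
  exact: rvol_mono.
rewrite /rdrift min_l; last by lra.
by rewrite ler_pdivrMr//; nra.
Qed.

Lemma lpot_moments beta S n k (M := fun p => \sum_(0 <= j < k.+1)
    (- lattice S j) ^+ p * expR (lpot beta S j)) :
  regime beta S n -> lattice S k <= 0 ->
  let y := - lattice S k in
  [/\ S * expR (lpot beta S k) <= 2 * M 1%N + 2 * S^-1 * M 0%N,
      M 2%N <= 2 * M 0%N + 2 * (y * (S * expR (lpot beta S k))) &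
      M 4%N <= 2 * (3 * M 2%N + 3 * S^-1 * M 1%N + S^-1 ^+ 2 * M 0%N
        + y ^+ 3 * (S * expR (lpot beta S k)))].
Proof.
move=> r xk; have [b0 S0 n0 nE] := r.
have iS0 : 0 < S^-1 by rewrite invr_gt0.
apply: (@tail_moments R S (fun j => - lattice S j) (fun j => expR (lpot beta S j)) k) => //.
- by move=> j; rewrite opprB.
- by rewrite oppr_ge0.
- move=> j jk; have x0 : lattice S j.+1 <= 0 by apply: le_trans xk; exact: lattice_mono.
  have xj : lattice S j <= lattice S j.+1 by exact: lattice_mono.
  have /andP[_] := potential_slope S0 b0 xj; rewrite -/(lpot beta S j) -/(lpot beta S j.+1).
  have -> : lattice S j.+1 - lattice S j = S^-1 by rewrite latticeS//; ring.
  have := ler_wpM2l (ltW iS0) (rdrift_le_id b0 S0 x0).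
  have := lattice_ge j.+1 S0; set x := lattice S j.+1 in x0 * => Sx h1 h2.
  set t := - (S^-1 * x).
  (* [- S <= x <= 0] puts [t] in the range where [expR (- t) <= 1 - t / 2]. *)
  have t01 : 0 <= t <= 1.
    rewrite /t -mulrN mulr_ge0 ?oppr_ge0 ?(ltW iS0)//=.
    by rewrite mulrC ler_pdivrMr// mul1r lerNl.
  have := expR_opp_le t01.
  have : expR (lpot beta S j) <= expR (lpot beta S j.+1) * expR (- t).
    by rewrite -expRD ler_expR /t; lra.
  have := expR_gt0 (lpot beta S j.+1).
  set w := expR (lpot beta S j.+1); set u := expR (lpot beta S j); set e := expR (- t).
  move=> w0 ue et.
  have : u <= w * (1 - t / 2) by apply: le_trans ue _; rewrite ler_pM2l.
  have tS : t * S = - x by rewrite /t; field; rewrite gt_eqF.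
  move=> H; have := ler_wpM2l (ltW S0) H.
  have -> : S * (w * (1 - t / 2)) = S * w - w * (t * S) / 2 by ring.
  rewrite tS; lra.
- move=> j jk; have x0 : lattice S j.+1 <= 0 by apply: le_trans xk; exact: lattice_mono.
  have xj : lattice S j <= lattice S j.+1 by exact: lattice_mono.
  have /andP[+ _] := potential_slope S0 b0 xj; rewrite -/(lpot beta S j) -/(lpot beta S j.+1).
  have xE : lattice S j.+1 - lattice S j = S^-1 by rewrite latticeS//; ring.
  rewrite xE => h1.
  have := rdrift_abs (lattice S j) b0 S0.
  have xj0 : lattice S j <= 0 by exact: le_trans xj x0.
  rewrite (ler0_norm xj0) ler_norml => /andP[h2 _].
  have := expR_ge1Dx (lpot beta S j - lpot beta S j.+1).
  have -> : expR (lpot beta S j) = expR (lpot beta S j.+1) * expR (lpot beta S j - lpot beta S j.+1).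
    by rewrite -expRD; congr expR; ring.
  have := expR_gt0 (lpot beta S j.+1).
  set w := expR (lpot beta S j.+1); set e := expR (_ - _).
  move=> w0 ee.
  set x := lattice S j in h1 h2 xE xj0 xj *.
  have -> : - lattice S j.+1 + S^-1 = - x by rewrite -xE; ring.
  have H : 1 - e <= 2 * (- x) * S^-1.
    have := ler_wpM2l (ltW iS0) h2; lra.
  have -> : S * (w - w * e) = (S * w) * (1 - e) by ring.
  apply: (@le_trans _ _ (S * w * (2 * (- x) * S^-1))).
    by rewrite ler_pM2l// mulr_gt0.
  have -> : S * w * (2 * - x * S^-1) = 2 * - x * w by field; rewrite gt_eqF.
  exact: lexx.
Qed.

(** The relations of [lpot_moments] close up: for [p] equal to 1, 2 or 4 the moment of order [p] is
    at most a constant times [(1 + y) ^+ p] times the zeroth one, where [- y] is the end of the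
    tail. Hence the average of [err] over the tail is of the order of [err] at its end, and the last
    weight is only a fraction [O((1 + y) / S)] of the mass. *)
Lemma err_tail beta : 0 < beta -> exists2 K : R, 0 < K &
  forall S n k, regime beta S n -> lattice S k <= 0 ->
  \sum_(0 <= j < k.+1) err S (lattice S j) * expR (lpot beta S j)
    <= K * err S (lattice S k) * \sum_(0 <= j < k.+1) expR (lpot beta S j) /\
  expR (lpot beta S k)
    <= K * err S (lattice S k) * \sum_(0 <= j < k.+1) expR (lpot beta S j).
Proof.
move=> b0; pose B := 1 + beta; have B1 : 1 < B by rewrite /B; lra.
pose K := 20 * B + 192 * 8 * B ^+ 3.
have BB : 0 < B by lra.
have B30 : 0 < B ^+ 3 by rewrite exprn_gt0.
exists K; first by rewrite /K; lra.
move=> S n k r xk; have [_ S0 n0 nE] := r.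
have iSB := regime_invS r; rewrite -/B in iSB.
have iS0 : 0 < S^-1 by rewrite invr_gt0.
have := lpot_moments r xk.
set y := - lattice S k; set T := S * expR _.
have yx : lattice S k = - y by rewrite opprK.
have y0 : 0 <= y by rewrite oppr_ge0.
pose M p := \sum_(0 <= j < k.+1) (- lattice S j) ^+ p * expR (lpot beta S j).
rewrite -/(M 0%N) -/(M 1%N) -/(M 2%N) -/(M 4%N) => -[I1 I2 I4].
have M0E : \sum_(0 <= j < k.+1) expR (lpot beta S j) = M 0%N.
  by apply: eq_bigr => j _; rewrite expr0 mul1r.
have sq a : 2 * a * M 1%N <= M 2%N + a ^+ 2 * M 0%N.
  rewrite -subr_ge0; have -> : M 2%N + a ^+ 2 * M 0%N - 2 * a * M 1%N =
      \sum_(0 <= j < k.+1) (- lattice S j - a) ^+ 2 * expR (lpot beta S j).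
    rewrite /M !mulr_sumr -big_split/= -sumrB; apply: eq_bigr => j _.
    by rewrite expr0 expr1; ring.
  by apply: sumr_ge0 => j _; rewrite mulr_ge0 ?sqr_ge0 ?expR_ge0.
have errE : \sum_(0 <= j < k.+1) err S (lattice S j) * expR (lpot beta S j)
    = (M 0%N + M 1%N) * S^-1 + M 4%N * S^-1 ^+ 2.
  rewrite /M -big_split/= !mulr_suml -big_split/= big_nat_cond [RHS]big_nat_cond.
  apply: eq_bigr => j; rewrite andbT => /andP[_ jk].
  have x0 : lattice S j <= 0 by apply: le_trans xk; apply: lattice_mono.
  by rewrite /err (ler0_norm x0) expr0 expr1 exprVn; ring.
rewrite errE M0E.
have M0 : 0 < M 0%N.
  rewrite -M0E big_nat_recr//=; apply: ltr_wpDl; last exact: expR_gt0.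
  by apply: sumr_ge0 => j _; rewrite expR_ge0.
(* With [a = 4 * y] the term [4 * y * m1], produced by inserting [I1] into [I2], is absorbed by half
   of [m2]. With [a = 1 + y] the bound on [m2] becomes one on [m1]. *)
have S1 := sq (4 * y); have S2 := sq (1 + y).
move: I1 I2 I4 S1 S2 M0; clear sq errE M0E.
set m0 := M 0%N; set m1 := M 1%N; set m2 := M 2%N; set m4 := M 4%N; set d := S^-1.
move=> I1 I2 I4 S1 S2 m00.
have d0 : 0 < d by [].
have dB : d <= B := iSB.
have Y1 : 1 <= 1 + y by lra.
have h2 : m2 <= 16 * B * (1 + y) ^+ 2 * m0.
  have c : 4 + 16 * y ^+ 2 + 8 * (d * y) <= 16 * B * (1 + y) ^+ 2.
    have : d * y <= B * y by rewrite ler_wpM2r.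
    have : y ^+ 2 <= B * y ^+ 2 by rewrite ler_peMl ?sqr_ge0// ltW.
    have : 0 <= B * y by rewrite mulr_ge0// ltW.
    have -> : 16 * B * (1 + y) ^+ 2 = 16 * B + 32 * (B * y) + 16 * (B * y ^+ 2) by ring.
    lra.
  apply: le_trans (ler_wpM2r (ltW m00) c).
  have := ler_wpM2l y0 I1; lra.
have [Y0 m0' B0' d0'] : [/\ 0 <= 1 + y, 0 <= m0, 0 <= B & 0 <= d].
  by split; [exact: addr_ge0|exact: ltW..].
have h1 : m1 <= 9 * B * (1 + y) * m0.
  have Y2 : 0 < 2 * (1 + y) by lra.
  rewrite -(ler_pM2l Y2); apply: le_trans S2 _.
  have : 0 <= (B - 1) * ((1 + y) ^+ 2 * m0) by rewrite !mulr_ge0 ?sqr_ge0//; lra.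
  have : 0 <= (1 + y) ^+ 2 * m0 by rewrite mulr_ge0 ?sqr_ge0.
  lra.
have hT : T <= 20 * B * (1 + y) * m0.
  have : d * m0 <= B * m0 by rewrite ler_wpM2r.
  have : 0 <= B * (y * m0) by rewrite !mulr_ge0.
  lra.
(* [192 = 2 * (48 + 27 + 1 + 20)], one summand for each term of [I4] after inserting [h2], [h1] and
   [hT]. *)
have h4 : m4 <= 192 * B ^+ 2 * (1 + y) ^+ 4 * m0.
  have pow a b p : 0 <= a -> a <= B ^+ 2 -> 0 <= b -> b <= (1 + y) ^+ p ->
      (p <= 4)%N -> a * b * m0 <= B ^+ 2 * (1 + y) ^+ 4 * m0.
    move=> a0 aB b0' bY p4; apply: ler_wpM2r => //; apply: ler_pM => //.
    by apply: le_trans bY _; rewrite ler_weXn2l.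
  have BB2 : B <= B ^+ 2 by rewrite expr2 ler_peMr// ltW.
  have t1 := pow B ((1 + y) ^+ 2) 2%N B0' BB2 (sqr_ge0 _) (lexx _) isT.
  have dBB : d * B <= B ^+ 2 by rewrite expr2 ler_wpM2r.
  have t2 := pow (d * B) (1 + y) 1%N (mulr_ge0 d0' B0') dBB Y0 (lexx _) isT.
  have dd : d ^+ 2 <= B ^+ 2 by apply: lerXn2r.
  have t3 := pow (d ^+ 2) 1 0%N (sqr_ge0 _) dd ler01 (lexx _) isT.
  have y3 : y ^+ 3 * (1 + y) <= (1 + y) ^+ 4.
    rewrite [leRHS]exprSr; apply: ler_wpM2r => //.
    by apply: lerXn2r; rewrite ?nnegrE//; clear; lra.
  have t4 := pow B (y ^+ 3 * (1 + y)) 4%N B0' BB2 (mulr_ge0 (exprn_ge0 3 y0) Y0) y3 isT.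
  have := ler_wpM2l (exprn_ge0 3 y0) hT; have := ler_wpM2l d0' h1.
  lra.
have p4 : (1 + y) ^+ 4 <= 8 * (1 + y ^+ 4).
  have a1 := sqr_ge0 (1 - y); have a2 := sqr_ge0 (1 - y ^+ 2).
  have a3 := sqr_ge0 (1 + y).
  have : ((1 + y) ^+ 2) ^+ 2 <= (2 * (1 + y ^+ 2)) ^+ 2.
    by apply: lerXn2r; rewrite ?nnegrE ?sqr_ge0//; [have := sqr_ge0 y; clear; lra|clear - a1; lra].
  lra.
have errd : err S (lattice S k) = (1 + y) * d + y ^+ 4 * d ^+ 2.
  rewrite /err (ler0_norm xk) -/y yx /d; clear -S0; clearbody y.
  by field; rewrite gt_eqF.
rewrite errd; clearbody m0 m1 m2 m4.
have q1 : 0 <= (1 + y) * d * m0 by rewrite !mulr_ge0.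
have q2 : 0 <= y ^+ 4 * d ^+ 2 * m0 by rewrite !mulr_ge0 ?exprn_ge0.
have KB : 20 * B <= K by rewrite /K; lra.
split; last first.
  apply: (@le_trans _ _ (20 * B * ((1 + y) * d + y ^+ 4 * d ^+ 2) * m0)); last first.
    by rewrite ler_wpM2r// ler_wpM2r// addr_ge0// mulr_ge0// exprn_ge0.
  have TE : expR (lpot beta S k) = d * (S * expR (lpot beta S k)).
    by rewrite /d; field; rewrite gt_eqF.
  rewrite TE -/T; have := ler_wpM2l d0' hT; have := mulr_ge0 B0' q2; clear; lra.
have : m4 * d ^+ 2 <= 192 * B ^+ 2 * (8 * (1 + y ^+ 4)) * m0 * d ^+ 2.
  apply: ler_wpM2r; first by rewrite sqr_ge0.
  apply: le_trans h4 _; apply: ler_wpM2r => //; apply: ler_wpM2l => //.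
  by rewrite mulr_ge0// sqr_ge0.
have : (m0 + m1) * d <= 10 * B * ((1 + y) * d * m0).
  have : m1 * d <= 9 * B * (1 + y) * m0 * d by rewrite ler_wpM2r.
  have : 0 <= (B - 1) * ((1 + y) * d * m0) by rewrite mulr_ge0//; lra.
  have : 0 <= y * d * m0 by rewrite !mulr_ge0.
  lra.
have B3 : B ^+ 3 = B ^+ 2 * B by ring.
have : B ^+ 2 * (d ^+ 2 * m0) <= B ^+ 3 * ((1 + y) * d * m0).
  rewrite B3 -mulrA ler_wpM2l ?exprn_ge0//.
  have -> : d ^+ 2 * m0 = d * (d * m0) by ring.
  have -> : B * ((1 + y) * d * m0) = B * (1 + y) * (d * m0) by ring.
  rewrite ler_wpM2r ?mulr_ge0//; apply: le_trans dB _; rewrite ler_peMr//.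
have : B ^+ 2 * (y ^+ 4 * d ^+ 2 * m0) <= B ^+ 3 * (y ^+ 4 * d ^+ 2 * m0).
  by rewrite ler_wpM2r// B3 ler_peMr ?exprn_ge0// ltW.
have : 0 <= B * (y ^+ 4 * d ^+ 2 * m0) by rewrite mulr_ge0.
have : 0 <= B * ((1 + y) * d * m0) by rewrite mulr_ge0.
rewrite /K; lra.
Qed.

End TailErrors.

(** * Comparison of the two laws *)

Section Comparison.
Context {R : realType}.
Implicit Types (beta S kp : R) (n k : nat) (Y : R -> R) (q : nat -> R).

Definition partial q k : R := \sum_(0 <= j < k) q j.

(* [q k] is the stationary probability of state [k]. *)
Record queue_law S n q : Prop := QueueLaw {
  queue_ge0 : forall k, 0 <= q k;
  queue_below : forall k, (k < n)%N -> q k = k.+1%:R / S ^+ 2 * q k.+1;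
  queue_above : forall k, (n <= k)%N -> q k.+1 = S ^+ 2 / n%:R * q k;
  queue_total : partial q k @[k --> \oo] --> (1 : R) }.

(* [Y x] is the probability of the half-line [(-oo, x)] under the law whose
   density is [dens S beta kp]. *)
Record diffusion_law beta S kp Y : Prop := DiffusionLaw {
  diff_range : forall x, 0 <= Y x <= 1;
  diff_lower : forall a b m, a <= b ->
    (forall x, a <= x <= b -> m <= dens S beta kp x) -> m * (b - a) <= Y b - Y a;
  diff_upper : forall a b m, a <= b ->
    (forall x, a <= x <= b -> dens S beta kp x <= m) -> Y b - Y a <= m * (b - a);
  diff_left : Y (- S) <= kp / S * expR (potential S beta (- S));
  diff_right : forall z, beta <= z -> 1 - Y z =
    kp / beta * expR (potential S beta beta)
      * expR (- (beta / (1 + beta / (2 * S))) * (z - beta)) }.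

(** The density at the lattice point without its factor [1 / rvol], times the spacing: the common
    reference for both laws. *)
Definition weight beta S kp k : R := kp / S * expR (lpot beta S k).

(** Cell [0] takes all the mass left of [lattice S 1], including that of [(-oo, - S)], so that the
    cells sum to [Y]. *)
Definition cell S Y k : R :=
  Y (lattice S k.+1) - (if k is 0 then 0 else Y (lattice S k)).

Lemma weight_gt0 beta S kp k : 0 < S -> 0 < kp -> 0 < weight beta S kp k.
Proof. by move=> S0 kp0; rewrite mulr_gt0 ?expR_gt0// divr_gt0. Qed.

Lemma sum_cell S Y k : \sum_(0 <= j < k.+1) cell S Y j = Y (lattice S k.+1).
Proof.
elim: k => [|k IH]; first by rewrite big_nat1 /cell subr0.
by rewrite big_nat_recr//= IH /cell addrC subrK.
Qed.

Lemma diff_mono beta S kp Y (a b : R) : 0 < beta -> 0 < S -> 0 < kp ->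
  diffusion_law beta S kp Y -> a <= b -> Y a <= Y b.
Proof.
move=> b0 S0 kp0 l ab; rewrite -subr_ge0 -(mul0r (b - a)).
by apply: (diff_lower l) => // x _; exact: dens_ge0.
Qed.

(** From [n] on the terms are geometric with ratio below 1, and total mass 1 turns the partial sums
    into a formula for the tail. *)
Lemma partial_above S n q k : (0 < n)%N -> S ^+ 2 < n%:R -> 0 < S -> queue_law S n q ->
  1 - partial q (n + k) = q n * (S ^+ 2 / n%:R) ^+ k * (n%:R / (n%:R - S ^+ 2)).
Proof.
move=> n0 Sn S0 l; have nR : 0 < n%:R :> R by rewrite ltr0n.
set rho := S ^+ 2 / n%:R.
have r0 : 0 <= rho by rewrite divr_ge0 ?sqr_ge0.
have r1 : rho < 1 by rewrite ltr_pdivrMr// mul1r.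
have -> : n%:R / (n%:R - S ^+ 2) = (1 - rho)^-1.
  by rewrite /rho; field; rewrite !gt_eqF ?subr_gt0.
have qE m : q (n + m)%N = q n * rho ^+ m.
  elim: m => [|m IH]; first by rewrite addn0 mulr1.
  by rewrite addnS (queue_above l) ?leq_addr// IH (exprS rho) -/rho mulrCA.
have pE m : partial q (n + m) = partial q n + q n * (1 - rho ^+ m) / (1 - rho).
  elim: m => [|m IH]; first by rewrite addn0 expr0 subrr mulr0 mul0r addr0.
  rewrite addnS {1}/partial big_nat_recr//= -/(partial q _) IH qE (exprS rho).
  by field; rewrite gt_eqF// subr_gt0.
have lim : partial q n + q n / (1 - rho) = 1.
  have c1 : (fun m => partial q (m + n)%N) @ \oo --> (1 : R).
    by rewrite cvg_shiftn; exact: queue_total l.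
  have c2 : (fun m => partial q (m + n)%N) @ \oo --> partial q n + q n / (1 - rho).
    have -> : (fun m => partial q (m + n)%N) =
        (fun m => partial q n + q n / (1 - rho) * (1 - rho ^+ m)).
      by apply/funext => m; rewrite addnC pE; congr (_ + _); rewrite mulrAC.
    apply: cvgD; first exact: cvg_cst.
    rewrite -[X in _ --> X]mulr1; apply: cvgM; first exact: cvg_cst.
    rewrite -[X in _ --> X]subr0; apply: cvgB; first exact: cvg_cst.
    by apply: cvg_expr; rewrite ger0_norm.
  by apply: (cvg_unique _ c2 c1).
transitivity (partial q n + q n / (1 - rho) - partial q (n + k)); first by rewrite lim.
by rewrite pE; clearbody rho; field; rewrite gt_eqF// subr_gt0.
Qed.

(** [dens_cell] integrated over a cell. Cell [0] also carries the mass left of [- S], at most one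
    more weight; this relative error of order one is covered because [err] at [- S] is bounded
    below. *)
Lemma cell_weight beta : 0 < beta -> exists2 K : R, 0 < K &
  forall S n kp Y k, regime beta S n -> 0 < kp -> diffusion_law beta S kp Y ->
  (k < n)%N ->
  `|cell S Y k - weight beta S kp k| <= K * err S (lattice S k) * weight beta S kp k.
Proof.
move=> b0; have [K K0 HK] := dens_cell b0.
pose K' := 16 * (1 + beta) ^+ 2.
have K'0 : 0 < K' by rewrite mulr_gt0// exprn_gt0// addr_gt0.
exists (K + K'); first by rewrite addr_gt0.
move=> S n kp Y k r kp0 l kn; have [_ S0 n0 nE] := r.
set e := err S (lattice S k); set w := weight beta S kp k.
have e0 : 0 <= e by exact: err_ge0.
have w0 : 0 < w by exact: weight_gt0.
have ab : lattice S k <= lattice S k.+1 by exact: lattice_mono.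
have wE : w = kp * expR (lpot beta S k) * S^-1 by rewrite /w /weight; ring.
have dS : lattice S k.+1 - lattice S k = S^-1 by rewrite latticeS//; ring.
have near y : lattice S k <= y <= lattice S k.+1 ->
    (1 - K * e) * (kp * expR (lpot beta S k)) <= dens S beta kp y
      <= (1 + K * e) * (kp * expR (lpot beta S k)).
  move=> hy; have := HK S n r k kp y kn kp0 hy; rewrite -/e ler_norml.
  by move=> /andP[h1 h2]; apply/andP; split; lra.
have base : `|Y (lattice S k.+1) - Y (lattice S k) - w| <= K * e * w.
  have lo := diff_lower l ab (fun y hy => proj1 (andP (near y hy))).
  have up := diff_upper l ab (fun y hy => proj2 (andP (near y hy))).
  rewrite dS in lo up; rewrite ler_norml wE; apply/andP; split; lra.
have split_K : (K + K') * e * w = K * e * w + K' * e * w by ring.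
rewrite split_K; rewrite /cell; case: k => [|k] in e w e0 w0 ab wE dS near base split_K kn *.
  have l0 : lattice S 0 = - S by rewrite /lattice mul0r sub0r.
  have Y0 : 0 <= Y (- S) <= w.
    by have /andP[-> _] := diff_range l (- S); rewrite /w /weight /lpot l0 (diff_left l).
  have K'e : 1 <= K' * e.
    have : - S <= - (S / 2) by lra.
    rewrite -l0 => /(err_ge_deep r); rewrite -/K' -/e => H.
    by rewrite mulrC -ler_pdivrMr// div1r.
  have : w <= K' * e * w by rewrite ler_peMl// ltW.
  move: base Y0; rewrite l0 subr0 !ler_norml => /andP[h1 h2] /andP[h3 h4].
  by move=> h5; apply/andP; split; lra.
apply: le_trans base _; rewrite lerDl; apply: mulr_ge0; last exact: ltW.
by apply: mulr_ge0 => //; exact: ltW.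
Qed.

Lemma queue_weight beta : 0 < beta -> exists2 K : R, 0 < K &
  forall S n kp q k, regime beta S n -> 0 < kp -> queue_law S n q -> 0 < q n ->
  (k <= n)%N ->
  `|weight beta S kp n / q n * q k - weight beta S kp k|
    <= K * err S (lattice S k) * weight beta S kp k.
Proof.
move=> b0; have [K K0 HK] := weight_comparison b0; exists K => //.
move=> S n kp q k r kp0 l qn kn; have [_ S0 n0 nE] := r.
have qE := log_ratioE r (queue_below l) kn.
have w0 : 0 < weight beta S kp k by exact: weight_gt0.
have -> : weight beta S kp n / q n * q k - weight beta S kp k =
    (expR (log_ratio beta S n k) - 1) * weight beta S kp k.
  rewrite qE /weight expRD expRB.
  have := expR_gt0 (lpot beta S n); set E := expR (lpot beta S n) => E0.
  by field; rewrite !gt_eqF.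
rewrite normrM (gtr0_norm w0) ler_pM2r//.
exact: HK.
Qed.

End Comparison.

(** * Comparison of partial sums and of the normalizations *)

Section TailComparison.
Context {R : realType}.
Implicit Types (beta S kp : R) (n k : nat) (Y : R -> R) (q : nat -> R).

Definition model beta S n kp q Y :=
  [/\ regime beta S n, 0 < kp, queue_law S n q & diffusion_law beta S kp Y].

(** Multiplying [q] by this factor makes it equal to [weight] at state [n]; it stands in for the
    unknown ratio of normalizing constants. *)
Definition norm_ratio beta S n kp q : R := weight beta S kp n / q n.

Lemma model_drop beta S n kp q Y : model beta S n kp q Y -> S ^+ 2 < n%:R.
Proof. by move=> [[b0 S0 n0 ->] _ _ _]; rewrite ltrDl mulr_gt0. Qed.

Lemma upper_mass beta S n kp q Y m : model beta S n kp q Y ->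
  1 - partial q (n + m) = q n * (S ^+ 2 / n%:R) ^+ m * ((S + beta) / beta).
Proof.
move=> md; have [r kp0 lq lY] := md; have [b0 S0 n0 nE] := r.
rewrite (partial_above _ n0 (model_drop md) S0 lq); congr (_ * _).
have bS : 0 < beta * S by rewrite mulr_gt0.
rewrite nE; have -> : S ^+ 2 + beta * S - S ^+ 2 = beta * S by ring.
by field; rewrite !gt_eqF.
Qed.

(** If [q n] vanished, so would all mass below [n] by [log_ratioE] and all mass from [n] on by
    [upper_mass]. *)
Lemma queue_pos beta S n kp q Y : model beta S n kp q Y -> 0 < q n.
Proof.
move=> md; have [r kp0 lq lY] := md; have [b0 S0 n0 nE] := r.
rewrite lt_neqAle (queue_ge0 lq) andbT eq_sym; apply/eqP => qn.
have := upper_mass 0 md; rewrite addn0 qn !mul0r => /eqP.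
rewrite subr_eq0 => /eqP H.
have : partial q n = 0.
  rewrite /partial big_nat_cond big1// => j /andP[/andP[_ jn] _].
  by rewrite (log_ratioE r (queue_below lq) (ltnW jn)) qn mul0r.
by rewrite -H => /eqP; rewrite oner_eq0.
Qed.

Lemma sum_compare beta : 0 < beta -> exists2 K : R, 0 < K &
  forall S n kp q Y k, model beta S n kp q Y -> (k < n)%N ->
  `|norm_ratio beta S n kp q * partial q k.+1 - Y (lattice S k.+1)|
    <= K * \sum_(0 <= j < k.+1) err S (lattice S j) * weight beta S kp j.
Proof.
move=> b0; have [K1 K10 H1] := cell_weight b0; have [K2 K20 H2] := queue_weight b0.
exists (K1 + K2); first by rewrite addr_gt0.
move=> S n kp q Y k md kn; have [r kp0 lq lY] := md.
have qn := queue_pos md.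
rewrite -sum_cell /partial [X in `|X - _|]mulr_sumr -sumrB mulr_sumr.
apply: le_trans (ler_norm_sum _ _ _) _; apply: ler_sum_nat => j /andP[_ jk].
have jn : (j < n)%N by exact: leq_trans jk kn.
have h1 := H1 S n kp Y j r kp0 lY jn.
have h2 := H2 S n kp q j r kp0 lq qn (ltnW jn).
rewrite -/(norm_ratio _ _ _ _ _) in h2.
have -> : norm_ratio beta S n kp q * q j - cell S Y j =
  (norm_ratio beta S n kp q * q j - weight beta S kp j) - (cell S Y j - weight beta S kp j).
  by ring.
apply: le_trans (ler_normB _ _) _; lra.
Qed.

Lemma weights_total beta : 0 < beta -> exists2 K : R, 0 < K &
  forall S n kp, regime beta S n -> 0 < kp ->
  \sum_(0 <= j < n) err S (lattice S j) * weight beta S kp j <= K * kp / S /\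
  \sum_(0 <= j < n) weight beta S kp j <= K * kp.
Proof.
move=> b0; have [K K0 HK] := weight_sums b0; exists K => // S n kp r kp0.
have [_ S0 n0 nE] := r; have [h1 h2] := HK S n r.
have c0 : 0 <= kp / S by rewrite divr_ge0// ltW.
split.
  have -> : K * kp / S = kp / S * K by ring.
  apply: le_trans (ler_wpM2l c0 h1); rewrite mulr_sumr le_eqVlt; apply/orP; left.
  by apply/eqP/eq_bigr => j _; rewrite /weight mulrCA.
have -> : K * kp = kp / S * (K * S) by field; rewrite gt_eqF.
by apply: le_trans (ler_wpM2l c0 h2); rewrite mulr_sumr.
Qed.

Lemma lpot_n beta S n : regime beta S n ->
  - (beta * beta) <= lpot beta S n <= 0 /\ lpot beta S n = potential S beta beta.
Proof.
move=> r; have [b0 S0 n0 nE] := r; rewrite /lpot (lattice_n r); split => //.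
by rewrite potential_le0// potential_ge// ltW.
Qed.

(** Everything comes from total mass 1. The mass of [Y1] above [beta] bounds [kp] from above, and
    adding the mass below [beta] bounds it from below. For the ratio, the parts below [beta] are
    compared by [sum_compare], while the parts above differ by exactly the weight of [n], which is
    [O(1 / S)]. *)
Lemma normalization beta : 0 < beta -> exists2 K : R, 0 < K &
  forall S n kp q Y, model beta S n kp q Y ->
  [/\ kp <= K, 1 <= K * kp & `|norm_ratio beta S n kp q - 1| <= K / S].
Proof.
move=> b0; have [K1 K10 H1] := sum_compare b0; have [K2 K20 H2] := weights_total b0.
have [K3 K30 H3] := cell_weight b0.
pose B := 1 + beta; pose E := expR (beta * beta).
have E0 : 0 < E := expR_gt0 _.
have B0 : 0 < B by rewrite addr_gt0.
pose A := K2 + K3 * K2 * B + beta^-1.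
have A0 : 0 < A by rewrite !addr_gt0 ?mulr_gt0 ?invr_gt0.
pose D := (K1 * K2 + 1) * (beta * E).
have D0 : 0 < D by rewrite !mulr_gt0// addr_gt0// mulr_gt0.
have bE0 : 0 < beta * E by rewrite mulr_gt0.
exists (beta * E + A + D); first by lra.
move=> S n kp q Y md; have [r kp0 lq lY] := md; have [_ S0 n0 nE] := r.
have iSB := regime_invS r; rewrite -/B in iSB.
have iS0 : 0 < S^-1 by rewrite invr_gt0.
have [/andP[I1 I2] IE] := lpot_n r.
have := diff_right lY (lexx beta); rewrite subrr mulr0 expR0 mulr1 -IE.
have [h1 h2] := H2 S n kp r kp0.
have /andP[Y0 Y1] := diff_range lY beta.
move=> YE.
have eI0 := expR_gt0 (lpot beta S n).
have eI1 : expR (lpot beta S n) <= 1 by rewrite -expR0 ler_expR.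
have eIE : 1 <= expR (lpot beta S n) * E.
  by rewrite /E -expRD -expR0 ler_expR; lra.
have kpK : kp <= beta * E.
  have : kp / beta * expR (lpot beta S n) <= 1 by lra.
  rewrite mulrAC ler_pdivrMr// mul1r => h.
  have := ler_wpM2r (ltW E0) h; rewrite -mulrA.
  apply: le_trans; rewrite ler_peMr// ltW//.
have [n' n'E] : exists n', n = n'.+1 by case: n n0 {r md lq nE h1 h2 IE I1 I2 YE eI0 eI1 eIE} => // n' _; exists n'.
have n'n : (n' < n)%N by rewrite n'E.
have Yb : Y beta = \sum_(0 <= j < n) cell S Y j by rewrite n'E sum_cell -n'E (lattice_n r).
split.
- by lra.
- have : Y beta <= (K2 + K3 * K2 * B) * kp.
    rewrite Yb; apply: (@le_trans _ _ (\sum_(0 <= j < n) (weight beta S kp j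
        + K3 * (err S (lattice S j) * weight beta S kp j)))).
      apply: ler_sum_nat => j /andP[_ jn].
      have := H3 S n kp Y j r kp0 lY jn; rewrite ler_norml => /andP[_]; lra.
    rewrite big_split/= -[X in _ + X]mulr_sumr.
    have := ler_wpM2l (ltW K30) h1.
    have : K3 * (K2 * kp / S) <= K3 * K2 * B * kp.
      have -> : K3 * (K2 * kp / S) = K3 * K2 * kp * S^-1 by ring.
      have -> : K3 * K2 * B * kp = K3 * K2 * kp * B by ring.
      by rewrite ler_pM2l// !mulr_gt0.
    lra.
  have : 1 - Y beta <= beta^-1 * kp.
    rewrite YE (mulrC kp) -mulrA ler_pM2l ?invr_gt0//.
    by rewrite ler_piMr// ltW.
  have : A * kp <= (beta * E + A + D) * kp by rewrite ler_pM2r//; lra.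
  rewrite /A; lra.
- have := H1 S n kp q Y n' md n'n; rewrite -n'E (lattice_n r).
  set c := norm_ratio _ _ _ _ _.
  have cq : c * q n = weight beta S kp n by rewrite /c /norm_ratio divfK// gt_eqF// (queue_pos md).
  have := upper_mass 0 md; rewrite addn0 expr0 mulr1 => um.
  have cu : c * (1 - partial q n) = kp / beta * expR (lpot beta S n) + kp / S * expR (lpot beta S n).
    by rewrite um mulrA cq /weight; field; rewrite !gt_eqF.
  have wS : kp / S * expR (lpot beta S n) <= kp / S.
    by rewrite ler_piMr// divr_ge0// ltW.
  have wS0 : 0 <= kp / S * expR (lpot beta S n) by rewrite mulr_ge0 ?divr_ge0// ltW.
  have := ler_wpM2l (ltW K10) h1 => t1 t2.
  have t3 : `|c - 1| <= K1 * (K2 * kp / S) + kp / S.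
    have -> : c - 1 = (c * partial q n - Y beta) + (c * (1 - partial q n) - (1 - Y beta)) by ring.
    apply: le_trans (ler_normD _ _) _; apply: lerD; first exact: le_trans t2 t1.
    by rewrite cu YE addrC addKr ger0_norm.
  apply: le_trans t3 _.
  have -> : K1 * (K2 * kp / S) + kp / S = (K1 * K2 + 1) * kp * S^-1 by ring.
  rewrite ler_pM2r//; apply: (@le_trans _ _ D); last by lra.
  by rewrite /D ler_pM2l// addr_gt0// mulr_gt0.
Qed.

End TailComparison.

(** * Upper tail *)

Section Tails.
Context {R : realType}.
Implicit Types (beta S kp z Q : R) (n k : nat) (Y : R -> R) (q : nat -> R).

Lemma dens_le beta S kp (x : R) : 0 < beta -> 0 < S -> 0 < kp -> dens S beta kp x <= 2 * kp.
Proof.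
move=> b0 S0 kp0; have v2 := rvol_ge S0 b0 x; have v0 := rvol_gt0 S0 b0 x.
have iv2 : (rvol S beta x)^-1 <= 2 by rewrite -[leRHS]invrK lef_pV2 ?posrE.
have e1 : expR (potential S beta x) <= 1 by rewrite -expR0 ler_expR potential_le0.
have iv0 : 0 < (rvol S beta x)^-1 by rewrite invr_gt0.
apply: (@le_trans _ _ (kp * (rvol S beta x)^-1)).
  by rewrite /dens ler_piMr// ltW// mulr_gt0.
by rewrite mulrC ler_pM2r.
Qed.

Lemma partial_mono q j k : (forall i, 0 <= q i) -> (j <= k)%N ->
  partial q j <= partial q k.
Proof.
move=> q0 /subnKC <-; elim: (k - j)%N => [|m IH]; first by rewrite addn0.
by apply: le_trans IH _; rewrite addnS /partial big_nat_recr//= lerDl.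
Qed.

Lemma ratio_sub1 (a b c e t : R) : 0 < b -> `|a - c * b| <= e * b -> `|c - 1| <= t ->
  `|a / b - 1| <= e + t.
Proof.
move=> b0 h1 h2.
have -> : a / b - 1 = (a - c * b) / b + (c - 1) by field; rewrite gt_eqF.
apply: le_trans (ler_normD _ _) _; apply: lerD => //.
by rewrite normrM (gtr0_norm (_ : 0 < b^-1)) ?invr_gt0// ler_pdivrMr.
Qed.

(** For [z <= beta] the tail contains the mass above [beta], which is bounded below by a constant,
    so an absolute error [O(1 / S)] is enough. *)
Lemma upper_tail_near beta : 0 < beta -> exists2 K : R, 0 < K &
  forall S n kp q Y z k, model beta S n kp q Y -> z <= beta ->
  lattice S k < z -> z <= lattice S k.+1 ->
  `|(1 - Y z) / (1 - partial q k.+1) - 1| <= K / S.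
Proof.
move=> b0; have [K1 K10 H1] := sum_compare b0; have [K2 K20 H2] := weights_total b0.
have [K3 K30 H3] := normalization b0.
pose B := 1 + beta; have B0 : 0 < B by rewrite addr_gt0.
pose E := expR (beta * beta); have E0 : 0 < E := expR_gt0 _.
(* The three sources of absolute error: the normalization, the summed cell errors, and the piece of
   a cell between [z] and the next lattice point, where the density is at most [2 * kp]. *)
pose A := K3 + K1 * K2 * K3 + 2 * K3.
have A0 : 0 < A by rewrite /A !addr_gt0// !mulr_gt0.
pose D := (1 + K3 * B) * (K3 * beta * E).
have D0 : 0 < D by rewrite !mulr_gt0// addr_gt0// mulr_gt0.
exists (A * D + K3); first by rewrite addr_gt0// mulr_gt0.
move=> S n kp q Y z k md zb kz zk; have [r kp0 lq lY] := md; have [_ S0 n0 nE] := r.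
have iSB := regime_invS r; rewrite -/B in iSB.
have iS0 : 0 < S^-1 by rewrite invr_gt0.
have [h1 h2] := H2 S n kp r kp0.
have [k1 k2 k3] := H3 S n kp q Y md.
have [/andP[I1 I2] IE] := lpot_n r.
have kn : (k < n)%N.
  rewrite ltnNge; apply/negP => /(lattice_mono S0); rewrite (lattice_n r); lra.
set c := norm_ratio beta S n kp q in k3.
have qn := queue_pos md.
have w0 : 0 < weight beta S kp n by exact: weight_gt0.
have c0 : 0 < c by rewrite divr_gt0.
have cB : c <= 1 + K3 * B.
  have : K3 / S <= K3 * B by rewrite ler_pM2l.
  by move: k3; rewrite ler_norml => /andP[_]; lra.
have um := upper_mass 0 md; rewrite addn0 expr0 mulr1 in um.
have cq : c * q n = weight beta S kp n by rewrite /c /norm_ratio divfK// gt_eqF.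
have mass : kp / beta * expR (lpot beta S n) <= c * (1 - partial q n).
  rewrite um mulrA cq /weight.
  have -> : kp / S * expR (lpot beta S n) * ((S + beta) / beta) =
    kp / beta * expR (lpot beta S n) + kp / S * expR (lpot beta S n).
    by field; rewrite !gt_eqF.
  by rewrite lerDl mulr_ge0 ?expR_ge0// divr_ge0// ltW.
have pm : 1 - partial q n <= 1 - partial q k.+1.
  by rewrite lerD2l lerN2; exact: partial_mono (queue_ge0 lq) kn.
have bD : 1 <= D * (1 - partial q k.+1).
  have e0 := expR_gt0 (lpot beta S n).
  have eIE : 1 <= expR (lpot beta S n) * E.
    by rewrite /E -expRD -expR0 ler_expR; lra.
  have t1 : 1 <= K3 * beta * E * (kp / beta * expR (lpot beta S n)).
    have -> : K3 * beta * E * (kp / beta * expR (lpot beta S n)) =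
      (K3 * kp) * (expR (lpot beta S n) * E) by field; rewrite gt_eqF.
    by rewrite -[leLHS]mulr1; apply: ler_pM.
  have p0 : 0 < 1 - partial q n by rewrite um mulr_gt0// divr_gt0// addr_gt0.
  have t2 : c * (1 - partial q n) <= (1 + K3 * B) * (1 - partial q k.+1).
    by apply: ler_pM => //; exact: ltW.
  have KbE : 0 < K3 * beta * E by rewrite !mulr_gt0.
  apply: le_trans t1 _.
  have -> : D * (1 - partial q k.+1) = K3 * beta * E * ((1 + K3 * B) * (1 - partial q k.+1)).
    by rewrite /D; ring.
  by rewrite ler_pM2l//; exact: le_trans mass t2.
have p0 : 0 < 1 - partial q k.+1.
  by have := lt_le_trans ltr01 bD; rewrite pmulr_rgt0.
have diff : `|1 - Y z - c * (1 - partial q k.+1)| <= A / S.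
  have s1 : `|c * partial q k.+1 - Y (lattice S k.+1)| <= K1 * (K2 * K3 / S).
    apply: le_trans (H1 S n kp q Y k md kn) _; rewrite ler_pM2l//.
    apply: (@le_trans _ _ (K2 * kp / S)); last by rewrite ler_pM2r// ler_pM2l.
    apply: le_trans h1; apply: (@partial_mono (fun j => err S (lattice S j) * weight beta S kp j)) => // j.
    by apply: mulr_ge0; [exact: err_ge0|exact/ltW/weight_gt0].
  have s2 := diff_mono b0 S0 kp0 lY zk.
  have s3 : Y (lattice S k.+1) - Y z <= 2 * K3 / S.
    apply: (@le_trans _ _ (2 * kp * (lattice S k.+1 - z))).
      by apply: (diff_upper lY) => // x _; exact: dens_le.
    apply: ler_pM; [by rewrite mulr_ge0// ltW|by rewrite subr_ge0|by rewrite ler_pM2l|].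
    by move: kz; rewrite latticeS//; lra.
  move: s1 k3 s2 s3; rewrite !ler_norml => /andP[a1 a2] /andP[a3 a4] s2 s3.
  have -> : A / S = K3 / S + K1 * (K2 * K3 / S) + 2 * K3 / S by rewrite /A; ring.
  clear - a1 a2 a3 a4 s2 s3; apply/andP; split; lra.
have -> : (A * D + K3) / S = A * D / S + K3 / S by ring.
apply: (ratio_sub1 p0 _ k3).
apply: le_trans diff _.
have AS : 0 <= A / S by rewrite divr_ge0// ltW.
have -> : A * D / S * (1 - partial q k.+1) = A / S * (D * (1 - partial q k.+1)) by ring.
by rewrite ler_peMr.
Qed.

(** Both tails are explicit, so their ratio is exactly [c * s * expR xi]. The exponents nearly
    cancel because [th / S] is the rational part of [ln_gap t]. What remains in [xi] is a fraction
    of one cell and [(x - beta) * (S * ln_gap t)], whose growth like [z / S ^+ 2] is the source of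
    the factor [1 + z / S]. *)
Lemma upper_tail_far beta : 0 < beta -> exists2 K : R, 0 < K &
  forall S n kp q Y z k, model beta S n kp q Y -> beta < z -> z <= S ^+ 2 ->
  lattice S k < z -> z <= lattice S k.+1 ->
  `|(1 - Y z) / (1 - partial q k.+1) - 1| <= K / S * (1 + z / S).
Proof.
move=> b0; have [K3 K30 H3] := normalization b0.
pose B := 1 + beta; have B0 : 0 < B by rewrite addr_gt0.
have B1 : 1 < B by rewrite /B; lra.
pose K4 := beta + beta ^+ 3 * B ^+ 2 + beta ^+ 3.
have K40 : 0 < K4 by rewrite /K4 !addr_gt0 ?mulr_gt0 ?exprn_gt0.
pose A := K4 * (B + 1).
have A0 : 0 < A by rewrite mulr_gt0// addr_gt0.
pose E := expR A; have E0 : 0 < E := expR_gt0 _.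
pose C := 1 + K3 * B; have C0 : 0 < C by rewrite addr_gt0// mulr_gt0.
exists (C * (K4 * E) + C * beta + K3); first by rewrite !addr_gt0 ?mulr_gt0.
move=> S n kp q Y z k md bz zS kz zk; have [r kp0 lq lY] := md; have [_ S0 n0 nE] := r.
have iSB := regime_invS r; rewrite -/B in iSB.
have iS0 : 0 < S^-1 by rewrite invr_gt0.
have [k1 k2 k3] := H3 S n kp q Y md.
have [/andP[I1 I2] IE] := lpot_n r.
set c := norm_ratio beta S n kp q in k3.
have qn := queue_pos md.
have w0 : 0 < weight beta S kp n by exact: weight_gt0.
have c0 : 0 < c by rewrite divr_gt0.
have cB : c <= C.
  have : K3 / S <= K3 * B by rewrite ler_pM2l.
  by rewrite /C; move: k3; rewrite ler_norml => /andP[_]; lra.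
have cq : c * q n = weight beta S kp n by rewrite /c /norm_ratio divfK// gt_eqF.
have nk : (n <= k.+1)%N.
  rewrite leqNgt; apply/negP => kn; have := lattice_mono S0 (ltnW kn).
  by rewrite (lattice_n r); lra.
set x := lattice S k.+1 in zk *.
pose m := (k.+1 - n)%N.
have kE : k.+1 = (n + m)%N by rewrite subnKC.
have mE : m%:R = S * (x - beta).
  by rewrite /m natrB// nE /x /lattice; field; rewrite gt_eqF.
have xz : x <= z + S^-1 by rewrite /x latticeS//; lra.
pose t := n%:R / S ^+ 2.
have tE : t = 1 + beta / S by rewrite /t nE; field; rewrite gt_eqF.
have bS0 : 0 < beta / S by rewrite divr_gt0.
have t1 : 1 <= t by rewrite tE; lra.
have t0 : 0 < t by lra.
pose th := beta / (1 + beta / (2 * S)).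
have thb : 0 <= th <= beta.
  have d0 : 0 < beta / (2 * S) by rewrite divr_gt0// mulr_gt0.
  rewrite /th divr_ge0 ?(ltW b0)//=; last by rewrite addr_ge0// ltW.
  by rewrite ler_pdivrMr ?addr_gt0// ler_peMr ?(ltW b0)//; lra.
have lnt : ln t = ln_gap t + th / S.
  rewrite /ln_gap -[LHS]addr0 -addrA; congr (_ + _); rewrite tE /th.
  have v1 : 1 + beta / (2 * S) != 0 by rewrite gt_eqF// addr_gt0// divr_gt0// mulr_gt0.
  have v2 : 2 * S + beta != 0 by rewrite gt_eqF// addr_gt0// mulr_gt0.
  by field; rewrite gt_eqF//= [X in _ && X](_ : _ = true) ?v2//; apply/negP; move/eqP; lra.
have /andP[g0 g1] := ln_gap_le t1.
pose xi := m%:R * ln t - th * (z - beta).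
have xiE : xi = th * (x - z) + (x - beta) * (S * ln_gap t).
  by rewrite /xi mE lnt; field; rewrite gt_eqF.
have xi0 : 0 <= xi.
  rewrite xiE; case/andP: thb => th0 _; rewrite addr_ge0// mulr_ge0 ?subr_ge0//; first by lra.
  by rewrite mulr_ge0// ltW.
have z0 : 0 < z := lt_trans b0 bz.
have xiK : xi <= K4 / S * (1 + z / S).
  case/andP: thb => th0 thb.
  have u1 : th * (x - z) <= beta * S^-1.
    by apply: ler_pM => //; rewrite ?subr_ge0//; lra.
  have Sg : S * ln_gap t <= beta ^+ 3 * S^-1 ^+ 2.
    have -> : beta ^+ 3 * S^-1 ^+ 2 = S * (t - 1) ^+ 3 by rewrite tE; field; rewrite gt_eqF.
    by rewrite ler_pM2l.
  have u2 : (x - beta) * (S * ln_gap t) <= (z + S^-1) * (beta ^+ 3 * S^-1 ^+ 2).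
    apply: ler_pM => //; [by clear - xz bz zk; lra|by rewrite mulr_ge0// ltW|by clear - xz b0; lra].
  have iS2 : S^-1 * S^-1 <= B * B by apply: ler_pM => //; exact: ltW.
  have b3 : 0 < beta ^+ 3 by rewrite exprn_gt0.
  have u3 : S^-1 * (beta ^+ 3 * S^-1 ^+ 2) <= beta ^+ 3 * B ^+ 2 * S^-1.
    have -> : S^-1 * (beta ^+ 3 * S^-1 ^+ 2) = beta ^+ 3 * (S^-1 * S^-1) * S^-1 by ring.
    by rewrite ler_pM2r// ler_pM2l// expr2.
  have zz : 0 <= z * S^-1 ^+ 2 by rewrite mulr_ge0 ?sqr_ge0// ltW.
  have : 0 <= beta * (z * S^-1 ^+ 2) by rewrite mulr_ge0// ltW.
  have : 0 <= beta ^+ 3 * B ^+ 2 * (z * S^-1 ^+ 2).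
    by rewrite mulr_ge0// mulr_ge0 ?sqr_ge0// ltW.
  have : 0 <= beta ^+ 3 * S^-1 by rewrite mulr_ge0// ltW.
  rewrite xiE /K4.
  have -> : (beta + beta ^+ 3 * B ^+ 2 + beta ^+ 3) / S * (1 + z / S) =
    beta * S^-1 + beta ^+ 3 * B ^+ 2 * S^-1 + beta ^+ 3 * S^-1 + beta * (z * S^-1 ^+ 2)
    + beta ^+ 3 * B ^+ 2 * (z * S^-1 ^+ 2) + beta ^+ 3 * (z * S^-1 ^+ 2) by ring.
  lra.
(* [z <= S ^+ 2] keeps [xi] bounded, so that [expR xi - 1] is controlled linearly by [xi]. *)
have eps : S^-1 * (1 + z / S) <= B + 1.
  have : z * (S^-1 * S^-1) <= 1.
    have -> : z * (S^-1 * S^-1) = z / S ^+ 2 by field; rewrite gt_eqF.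
    by rewrite ler_pdivrMr ?exprn_gt0// mul1r.
  lra.
have eps0 : 0 <= S^-1 * (1 + z / S).
  by rewrite mulr_ge0 ?addr_ge0 ?divr_ge0// ltW.
have xiA : xi <= A by apply: le_trans xiK _; rewrite -mulrA ler_pM2l.
have := expR_sub1_le xiA (ltW A0); rewrite (ger0_norm xi0) -/E => he.
have um := upper_mass m md; rewrite -kE in um.
have YE := diff_right lY (ltW bz); rewrite -/th -IE in YE.
pose s := S / (S + beta).
have Sb : 0 < S + beta by rewrite addr_gt0.
have s0 : 0 <= s by rewrite divr_ge0// ltW.
have s1 : s <= 1 by rewrite ler_pdivrMr// mul1r lerDl ltW.
have s2 : 1 - s <= beta / S.
  have -> : 1 - s = beta / (S + beta) by rewrite /s; field; rewrite gt_eqF.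
  by rewrite ler_pM2l// lef_pV2 ?posrE// lerDl ltW.
have rat : (1 - Y z) / (1 - partial q k.+1) = c * s * expR xi.
  have -> : expR xi = t ^+ m * expR (- th * (z - beta)).
    by rewrite /xi expRD expRM_natl lnK// mulNr.
  rewrite um YE.
  have -> : kp / beta * expR (lpot beta S n) = c * q n * (S / beta).
    by rewrite cq /weight; field; rewrite !gt_eqF.
  have -> : S ^+ 2 / n%:R = t^-1 by rewrite /t invf_div.
  rewrite exprVn; have tm : 0 < t ^+ m by rewrite exprn_gt0.
  by rewrite /s; move: tm (expR _) => tm X; field; rewrite !gt_eqF.
rewrite rat.
have -> : c * s * expR xi - 1 = c * s * (expR xi - 1) + c * (s - 1) + (c - 1) by ring.
apply: le_trans (ler_normD _ _) _.
have e1 : `|c * s * (expR xi - 1)| <= C * (K4 * E) / S * (1 + z / S).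
  have cs : 0 <= c * s by rewrite mulr_ge0// ltW.
  have csC : c * s <= C by apply: le_trans cB; rewrite ler_piMr// ltW.
  rewrite normrM (ger0_norm cs).
  have -> : C * (K4 * E) / S * (1 + z / S) = C * (K4 / S * (1 + z / S) * E) by ring.
  apply: ler_pM => //; apply: le_trans he _; by rewrite ler_pM2r.
have e2 : `|c * (s - 1)| <= C * beta / S.
  rewrite normrM (gtr0_norm c0) distrC ger0_norm ?subr_ge0// -mulrA.
  by apply: ler_pM => //; rewrite ?subr_ge0// ltW.
have zz : 0 <= z / S by rewrite divr_ge0// ltW.
have e3 : C * beta / S <= C * beta / S * (1 + z / S).
  by rewrite ler_peMr ?lerDl// divr_ge0 ?mulr_ge0// ltW.
have e4 : K3 / S <= K3 / S * (1 + z / S).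
  by rewrite ler_peMr ?lerDl// divr_ge0// ltW.
apply: le_trans (lerD (le_trans (ler_normD _ _) (lerD e1 e2)) k3) _.
have -> : (C * (K4 * E) + C * beta + K3) / S * (1 + z / S) =
  C * (K4 * E) / S * (1 + z / S) + C * beta / S * (1 + z / S) + K3 / S * (1 + z / S) by ring.
by clear - e3 e4; lra.
Qed.

End Tails.

(** * Lower tail *)

Section LowerTail.
Context {R : realType}.
Implicit Types (beta S kp z Q : R) (n k : nat) (Y : R -> R) (q : nat -> R).

(** Bounded [S] bounds [n], so [q 0] and [q n] differ by boundedly many bounded factors, and state
    [0] belongs to every lower tail. *)
Lemma queue_lower_small beta S0 : 0 < beta -> 0 < S0 -> exists2 a : R, 0 < a &
  forall S n kp q Y k, model beta S n kp q Y -> S <= S0 ->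
  a <= norm_ratio beta S n kp q * partial q k.+1.
Proof.
move=> b0 S00; have [K K0 HK] := normalization b0.
pose N := Num.truncn (S0 ^+ 2 + beta * S0).
(* The summand 1 ensures [b <= 1], so that [b ^+ N <= b ^+ n] when [n <= N]. *)
pose b : R := (1 + S0 ^+ 2)^-1.
have S02 : 0 < S0 ^+ 2 by rewrite exprn_gt0.
have b00 : 0 < b by rewrite invr_gt0 addr_gt0.
have b1 : b <= 1 by rewrite invf_le1 ?addr_gt0// lerDl ltW.
pose E := expR (beta * beta); have E0 : 0 < E := expR_gt0 _.
exists (b ^+ N * (K * S0 * E)^-1).
  by rewrite mulr_gt0 ?exprn_gt0// invr_gt0 !mulr_gt0.
move=> S n kp q Y k md SS; have [r kp0 lq lY] := md; have [_ Sp n0 nE] := r.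
have [k1 k2 k3] := HK S n kp q Y md.
have [/andP[I1 I2] IE] := lpot_n r.
have qn := queue_pos md.
have w0 : 0 < weight beta S kp n by exact: weight_gt0.
have S2 : 0 < S ^+ 2 by rewrite exprn_gt0.
have SS2 : S ^+ 2 <= S0 ^+ 2 by apply: lerXn2r; rewrite ?nnegrE// ltW.
have step j : (j < n)%N -> b * q j.+1 <= q j.
  move=> jn; rewrite (queue_below lq jn); apply: ler_wpM2r; first exact: (queue_ge0 lq).
  rewrite /b -[leLHS]mul1r; apply: ler_pM => //; first exact: ltW.
    by rewrite ler1n.
  by rewrite lef_pV2 ?posrE ?addr_gt0//; lra.
have q0 : b ^+ n * q n <= q 0%N.
  have gen j : (j <= n)%N -> b ^+ j * q j <= q 0%N.
    elim: j => [|j IH] jn; first by rewrite mul1r.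
    apply: le_trans (IH (ltnW jn)); rewrite exprSr -mulrA.
    by apply: ler_wpM2l (step j jn); rewrite exprn_ge0// ltW.
  exact: gen.
have nN : (n <= N)%N.
  rewrite /N truncn_ge_nat; last by rewrite addr_ge0 ?mulr_ge0// ltW.
  by rewrite nE; apply: lerD => //; rewrite ler_pM2l.
have bn : b ^+ N <= b ^+ n by apply: ler_wiXn2l => //; exact: ltW.
have cE : norm_ratio beta S n kp q * q n = weight beta S kp n.
  by rewrite /norm_ratio divfK// gt_eqF.
have c0 : 0 < norm_ratio beta S n kp q by rewrite divr_gt0.
apply: (@le_trans _ _ (norm_ratio beta S n kp q * (b ^+ n * q n))); last first.
  rewrite ler_pM2l//; apply: le_trans q0 _.
  have := @partial_mono _ q 1 k.+1 (queue_ge0 lq) isT.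
  by rewrite {1}/partial big_nat1.
rewrite mulrCA cE; apply: ler_pM => //.
- by rewrite exprn_ge0// ltW.
- by rewrite invr_ge0 !mulr_ge0// ltW.
have e0 := expR_gt0 (lpot beta S n).
have eIE : 1 <= expR (lpot beta S n) * E.
  by rewrite /E -expRD -expR0 ler_expR; lra.
have KSE : 0 < K * S0 * E by rewrite !mulr_gt0.
rewrite -[leLHS]mul1r ler_pdivrMr// /weight.
have -> : kp / S * expR (lpot beta S n) * (K * S0 * E) =
  (K * kp) * ((expR (lpot beta S n) * E) * (S0 / S)) by ring.
have S0S : 1 <= S0 / S by rewrite ler_pdivlMr// mul1r.
have h : 1 <= expR (lpot beta S n) * E * (S0 / S).
  by rewrite -[leLHS]mulr1; apply: ler_pM.
by rewrite -[leLHS]mulr1; apply: ler_pM.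
Qed.

(** Rounding [z] to a lattice point moves it by at most [1 / S], whose powers are bounded by
    constants. *)
Lemma err_near beta : 0 < beta -> exists2 K : R, 0 < K &
  forall S n (y z : R), regime beta S n -> 0 <= z -> z <= y -> y <= z + S^-1 ->
  err S (- y) <= K / S * (1 + z + z ^+ 4 / S).
Proof.
move=> b0; pose B := 1 + beta; have B0 : 0 < B by rewrite addr_gt0.
pose K := 1 + B + 8 * B ^+ 5 + 8.
have B5 : 0 < B ^+ 5 by rewrite exprn_gt0.
exists K; first by rewrite /K; lra.
move=> S n y z r z0 zy yz; have [_ S0 n0 nE] := r.
have iSB := regime_invS r; rewrite -/B in iSB.
have iS0 : 0 < S^-1 by rewrite invr_gt0.
have y0 : 0 <= y by lra.
have -> : err S (- y) = (1 + y) * S^-1 + y ^+ 4 * S^-1 ^+ 2.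
  by rewrite /err normrN (ger0_norm y0) exprVn; ring.
set d := S^-1 in iSB iS0 yz *.
have y4 : y ^+ 4 <= 8 * (z ^+ 4 + d ^+ 4).
  have t1 : (y ^+ 2) ^+ 2 <= (2 * (z ^+ 2 + d ^+ 2)) ^+ 2.
    have : y ^+ 2 <= (z + d) ^+ 2 by apply: lerXn2r; rewrite ?nnegrE//; lra.
    move=> t; apply: lerXn2r; rewrite ?nnegrE ?sqr_ge0//.
      by rewrite mulr_ge0// addr_ge0// sqr_ge0.
    by have := sqr_ge0 (z - d); lra.
  by have := sqr_ge0 (z ^+ 2 - d ^+ 2); lra.
have d5 : d ^+ 4 * d ^+ 2 <= B ^+ 5 * d.
  have -> : d ^+ 4 * d ^+ 2 = d ^+ 5 * d by ring.
  by rewrite ler_pM2r//; apply: lerXn2r; rewrite ?nnegrE// ltW.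
have d2 : 0 <= d ^+ 2 by rewrite sqr_ge0.
have h1 := ler_wpM2r d2 y4.
have zd : 0 <= z * d by rewrite mulr_ge0// ltW.
have h2 : (1 + y) * d <= (1 + z + B) * d by rewrite ler_pM2r//; lra.
have z4 : 0 <= z ^+ 4 * d ^+ 2 by rewrite mulr_ge0// exprn_ge0.
have Bzd : 0 <= B * (z * d) by rewrite mulr_ge0// ltW.
have B5zd : 0 <= B ^+ 5 * (z * d) by rewrite mulr_ge0// ltW.
have Bz4 : 0 <= B * (z ^+ 4 * d ^+ 2) by rewrite mulr_ge0// ltW.
have B5z4 : 0 <= B ^+ 5 * (z ^+ 4 * d ^+ 2) by rewrite mulr_ge0// ltW.
rewrite /K; lra.
Qed.

(* For large [S] the hypothesis [z ^ 2 <= c * S] makes the relative error at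
   most 1/2, which bounds the Poisson tail from below by the weights; bounded
   [S] is covered by [queue_lower_small]. *)
Lemma lower_tail beta : 0 < beta -> exists c K : R, [/\ 0 < c, 0 < K &
  forall S n kp q Y z Q k, model beta S n kp q Y -> 0 < z -> z ^+ 2 <= c * S ->
  lattice S k <= - z -> - z <= lattice S k.+1 ->
  Y (lattice S k) <= Q <= Y (lattice S k.+1) ->
  `|Q / partial q k.+1 - 1| <= K / S * (1 + z + z ^+ 4 / S)].
Proof.
move=> b0; have [K1 K10 H1] := sum_compare b0; have [K2 K20 H2] := weights_total b0.
have [K3 K30 H3] := normalization b0; have [K4 K40 H4] := cell_weight b0.
have [K5 K50 H5] := err_tail b0; have [K6 K60 H6] := err_near b0.
pose B := 1 + beta; have B0 : 0 < B by rewrite addr_gt0.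
pose L := (K1 + K4) * K5 * K6.
have L0 : 0 < L by rewrite !mulr_gt0// addr_gt0.
(* Chosen so that [8 * L * c <= 1]; with [S > Sx = 8 * L] this forces [L * eps <= 1/2] below. *)
pose c := (1 + 8 * L)^-1.
have L8 : 0 < 1 + 8 * L by lra.
have c0 : 0 < c by rewrite invr_gt0.
have c1 : c <= 1 by rewrite invf_le1//; lra.
have cL : 8 * L * c <= 1 by rewrite /c ler_pdivrMr//; lra.
pose Sx := 8 * L; have Sx0 : 0 < Sx by rewrite mulr_gt0.
have [a a0 Ha] := queue_lower_small b0 Sx0.
pose C := 1 + K3 * B; have C0 : 0 < C by rewrite addr_gt0// mulr_gt0.
pose M := 2 + K2 * K3 / a.
have M0 : 0 < M by rewrite addr_gt0// divr_gt0// mulr_gt0.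
pose K7 := (K1 * K5 + K5 + K4) * K6.
have K70 : 0 < K7 by rewrite mulr_gt0// !addr_gt0// mulr_gt0.
have K8 : 0 < K7 * (M * C) by rewrite mulr_gt0// mulr_gt0.
exists c, (K7 * (M * C) + K3); split=> //; first by rewrite addr_gt0.
move=> S n kp q Y z Q k md z0 zc kz zk /andP[Q1 Q2].
have [r kp0 lq lY] := md; have [_ S0 n0 nE] := r.
have iSB := regime_invS r; rewrite -/B in iSB.
have iS0 : 0 < S^-1 by rewrite invr_gt0.
have [k1 k2 k3] := H3 S n kp q Y md.
set d := norm_ratio beta S n kp q in k3.
have qn := queue_pos md.
have d0 : 0 < d by rewrite divr_gt0// weight_gt0.
have dC : d <= C.
  have : K3 / S <= K3 * B by rewrite ler_pM2l.
  by rewrite /C; move: k3; rewrite ler_norml => /andP[_]; lra.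
have kn : (k < n)%N.
  rewrite ltnNge; apply/negP => /(lattice_mono S0); rewrite (lattice_n r); lra.
have xk0 : lattice S k <= 0 by clear - kz z0; lra.
set e := err S (lattice S k).
have e0 : 0 <= e by exact: err_ge0.
pose eps := S^-1 * (1 + z + z ^+ 4 / S).
have zS4 : 0 <= z ^+ 4 / S by rewrite divr_ge0 ?exprn_ge0// ltW.
have eps0 : 0 <= eps by rewrite mulr_ge0 ?(ltW iS0)//; lra.
have eE : e <= K6 * eps.
  have := H6 S n (- lattice S k) z r (ltW z0); rewrite opprK /eps mulrA -/e; apply.
    by clear - kz; lra.
  by move: zk; rewrite latticeS//; clear; lra.
pose W := \sum_(0 <= j < k.+1) weight beta S kp j.
have kpS : 0 <= kp / S by rewrite divr_ge0// ltW.
have WE : W = kp / S * \sum_(0 <= j < k.+1) expR (lpot beta S j) by rewrite mulr_sumr.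
have [t1 t2] := H5 S n k r xk0; rewrite -/e in t1 t2.
have eW : \sum_(0 <= j < k.+1) err S (lattice S j) * weight beta S kp j <= K5 * e * W.
  have := ler_wpM2l kpS t1; rewrite mulr_sumr.
  have -> : kp / S * (K5 * e * \sum_(0 <= j < k.+1) expR (lpot beta S j)) = K5 * e * W.
    by rewrite WE; ring.
  apply: le_trans; rewrite le_eqVlt; apply/orP; left; apply/eqP/eq_bigr => j _.
  by rewrite /weight mulrCA.
have wW : weight beta S kp k <= K5 * e * W.
  have := ler_wpM2l kpS t2; rewrite -/(weight beta S kp k) WE.
  by have -> : kp / S * (K5 * e * \sum_(0 <= j < k.+1) expR (lpot beta S j)) =
    K5 * e * (kp / S * \sum_(0 <= j < k.+1) expR (lpot beta S j)) by ring.
have wpos j : 0 < weight beta S kp j by exact: weight_gt0.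
have W0 : 0 < W.
  rewrite /W big_nat_recr//=; apply: ltr_wpDl => //.
  by apply: sumr_ge0 => j _; rewrite ltW.
have wkW : weight beta S kp k <= W.
  by rewrite /W big_nat_recr//= lerDr; apply: sumr_ge0 => j _; rewrite ltW.
have s1 := H1 S n kp q Y k md kn; rewrite -/d in s1.
have {}s1 : `|d * partial q k.+1 - Y (lattice S k.+1)| <= K1 * (K5 * e * W).
  by apply: le_trans s1 _; rewrite ler_pM2l.
have cellW j : (j < k.+1)%N ->
    `|cell S Y j - weight beta S kp j| <= K4 * (err S (lattice S j) * weight beta S kp j).
  by move=> jk; rewrite mulrA; apply: H4 r kp0 lY _; exact: leq_trans jk kn.
have lowW : W - K4 * (K5 * e * W) <= Y (lattice S k.+1).
  rewrite -sum_cell; apply: (@le_trans _ _ (\sum_(0 <= j < k.+1)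
      (weight beta S kp j - K4 * (err S (lattice S j) * weight beta S kp j)))).
    by rewrite sumrB; apply: lerB => //; rewrite -mulr_sumr ler_pM2l.
  apply: ler_sum_nat => j /andP[_ jk].
  by have := cellW j jk; rewrite ler_norml => /andP[h _]; rewrite addrC -lerBrDr.
(* [Q] is meant to be the mass of a closed half-line, whereas [Y] measures open ones. Being trapped
   in cell [k] is enough, since that cell is a fraction [O(err)] of the tail. *)
have gapQ : Y (lattice S k.+1) - Q <= K5 * e * W + K4 * (e * W).
  have Q0 : (if k is 0 then 0 else Y (lattice S k)) <= Q.
    case: (k) Q1 => [|k'] // Q1; apply: le_trans Q1.
    by have /andP[] := diff_range lY (lattice S 0).
  have : Y (lattice S k.+1) - Q <= cell S Y k by rewrite /cell lerD2l lerN2.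
  move=> /le_trans; apply.
  have := cellW k (ltnSn k); rewrite ler_norml -/e => /andP[_ h].
  have h' : K4 * (e * weight beta S kp k) <= K4 * (e * W).
    by rewrite ler_pM2l// ler_wpM2l.
  rewrite -[cell S Y k](subrK (weight beta S kp k)) addrC.
  exact: lerD wW (le_trans h h').
have eWe : e * W <= K6 * eps * W by rewrite ler_pM2r.
have T0 : 0 < d * partial q k.+1.
  rewrite mulr_gt0//; apply: lt_le_trans (_ : q 0%N <= _).
    by rewrite (log_ratioE r (queue_below lq) (leq0n n)) mulr_gt0 ?expR_gt0.
  have := @partial_mono _ q 1 k.+1 (queue_ge0 lq) isT.
  by rewrite {1}/partial big_nat1.
have WT : W <= M * (d * partial q k.+1).
  case: (leP S Sx) => SS.
    have [_ h2] := H2 S n kp r kp0.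
    have : W <= K2 * kp.
      apply: le_trans h2; apply: (@partial_mono _ (weight beta S kp)) => // j.
      exact: ltW.
    have : K2 * kp <= K2 * K3 by rewrite ler_pM2l.
    have : K2 * K3 <= K2 * K3 / a * (d * partial q k.+1).
      rewrite mulrAC ler_pdivlMr// ler_pM2l ?mulr_gt0//.
      exact: Ha md SS.
    by rewrite /M; clear - T0; lra.
  (* [L / S] and [L * c] are at most 1/8, and [eps <= 3/2 * (1 / S + c)] follows from
     [z <= (1 + z ^+ 2) / 2], [z ^+ 2 <= c * S] and [c <= 1]. *)
  have Leps : L * eps <= 2^-1.
    have z2 : z <= (1 + z ^+ 2) / 2 by have := sqr_ge0 (1 - z); clear; lra.
    have zS : z * S^-1 <= (S^-1 + c) / 2.
      have : z * S^-1 <= (1 + c * S) / 2 * S^-1.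
        by rewrite ler_pM2r//; clear - z2 zc; lra.
      by have -> : (1 + c * S) / 2 * S^-1 = (S^-1 + c) / 2 by field; rewrite gt_eqF.
    have z4 : S^-1 * (z ^+ 4 / S) <= c.
      have -> : S^-1 * (z ^+ 4 / S) = (z ^+ 2) ^+ 2 / S ^+ 2 by field; rewrite gt_eqF.
      rewrite ler_pdivrMr ?exprn_gt0//; apply: (@le_trans _ _ ((c * S) ^+ 2)).
        by apply: lerXn2r; rewrite ?nnegrE ?sqr_ge0// mulr_ge0// ltW.
      by rewrite exprMn ler_pM2r ?exprn_gt0// expr2 ler_piMr// ltW.
    have LS : 8 * (L * S^-1) <= 1.
      by rewrite mulrA ler_pdivrMr// mul1r ltW.
    have ee : eps <= 3 / 2 * S^-1 + 3 / 2 * c.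
      have -> : eps = S^-1 + z * S^-1 + S^-1 * (z ^+ 4 / S) by rewrite /eps; ring.
      by clear - zS z4; lra.
    by have := ler_wpM2l (ltW L0) ee; clear - LS cL; lra.
  have h : (K1 + K4) * K5 * (e * W) <= L * eps * W.
    have -> : L * eps * W = (K1 + K4) * K5 * (K6 * eps * W) by rewrite /L; ring.
    by rewrite ler_pM2l// mulr_gt0// addr_gt0.
  have h' : L * eps * W <= 2^-1 * W by rewrite ler_pM2r.
  have hM : 2 * (d * partial q k.+1) <= M * (d * partial q k.+1).
    rewrite ler_pM2r// /M lerDl; apply: mulr_ge0; last by rewrite invr_ge0 ltW.
    by apply: mulr_ge0; exact: ltW.
  apply: le_trans hM; move: s1; rewrite ler_norml => /andP[s1 _].
  by clear - s1 lowW h h'; lra.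
have Tp : 0 < partial q k.+1 by rewrite -(pmulr_rgt0 _ d0).
have diff : `|Q - d * partial q k.+1| <= (K7 * (M * C)) * eps * partial q k.+1.
  have b1 : `|Q - d * partial q k.+1| <= (K1 * K5 + K5 + K4) * (e * W).
    move: s1; rewrite !ler_norml => /andP[h1 h2].
    have : 0 <= K5 * (e * W) by rewrite !mulr_ge0// ltW.
    have : 0 <= K4 * (e * W) by rewrite !mulr_ge0// ltW.
    by move=> h3 h4; clear - h1 h2 h3 h4 gapQ Q2; apply/andP; split; lra.
  have b2 : W <= M * C * partial q k.+1.
    apply: le_trans WT _; rewrite -mulrA ler_pM2l// ler_pM2r//.
  apply: le_trans b1 _.
  have -> : K7 * (M * C) * eps * partial q k.+1 =
    (K1 * K5 + K5 + K4) * (K6 * eps * (M * C * partial q k.+1)) by rewrite /K7; ring.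
  rewrite ler_pM2l; last by rewrite !addr_gt0// mulr_gt0.
  apply: le_trans eWe _; apply: ler_wpM2l => //; by rewrite mulr_ge0// ltW.
have K3e : K3 / S <= K3 * eps.
  rewrite ler_pM2l// /eps ler_peMr ?(ltW iS0)//.
  by clear - z0 zS4; lra.
have -> : (K7 * (M * C) + K3) / S * (1 + z + z ^+ 4 / S) =
  K7 * (M * C) * eps + K3 * eps by rewrite /eps; ring.
exact: ratio_sub1 Tp diff (le_trans k3 K3e).
Qed.

End LowerTail.

(** * Application to the Erlang-C model *)

Section Models.
Context {R : realType}.

Lemma scaled_stateE (lambda mu : R) k : 0 < load lambda mu ->
  scaled_state lambda mu k = lattice (Num.sqrt (load lambda mu)) k.
Proof.
move=> l0; rewrite /scaled_state /delta /lattice.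
have S0 : 0 < Num.sqrt (load lambda mu) by rewrite sqrtr_gt0.
have := sqr_sqrtr (ltW l0); move: S0; set s := Num.sqrt _ => S0 <-.
by field; rewrite gt_eqF.
Qed.

Lemma v1E (lambda mu beta x : R) : 0 < mu ->
  v1 lambda mu beta x = mu * rvol (Num.sqrt (load lambda mu)) beta x.
Proof.
move=> mu0; rewrite /v1 /diffusion /drift /delta /rvol -minr_pMr ?ltW//.
(* When the square root is [0], the convention [0^-1 = 0] makes both corrections vanish. *)
have [->|S0] := eqVneq (Num.sqrt (load lambda mu)) 0.
  by rewrite mulr0 invr0 mulr0 mul0r subr0 addr0; field.
by field.
Qed.

Lemma Y1_densityE (lambda mu beta kappa x : R) : 0 < mu ->
  Y1_density lambda mu beta kappa x
    = dens (Num.sqrt (load lambda mu)) beta (kappa / mu) x.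
Proof.
move=> mu0; rewrite /Y1_density /dens v1E// invfM mulrA; congr (_ * expR _).
rewrite /potential; congr (Defs.integral0 _ x); apply/funext => y.
rewrite v1E// /drift -minr_pMr ?ltW// /rdrift.
by rewrite invfM mulNr mulrACA divff ?gt_eqF// mul1r.
Qed.

Lemma partial_fine (pi : probability nat R) k :
  fine (pi `I_k) = partial (fun j => fine (pi [set j])) k.
Proof.
apply: EFin_inj; rewrite fineK ?fin_num_measure// /partial -sumEFin.
elim: k => [|k IH]; first by rewrite big_geq// II0 measure0.
rewrite big_nat_recr//= -IH fineK ?fin_num_measure// -measureU//; first by rewrite IIS.
by apply/seteqP; split => // j [/= jk jE]; rewrite jE ltnn in jk.
Qed.

Lemma queue_law_stationary (lambda mu : R) n (p : R -> R.-pker nat ~> nat)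
    (pi : probability nat R) : 0 < lambda -> 0 < mu -> (0 < n)%N ->
  erlangC_chain lambda mu n p -> stationary p pi ->
  queue_law (Num.sqrt (load lambda mu)) n (fun k => fine (pi [set k])).
Proof.
move=> l0 m0 n0 ch st.
have ld0 : 0 < load lambda mu by rewrite divr_gt0.
have bal := detailed_balance l0 m0 ch st.
split.
- by move=> k; exact: fine_ge0.
- move=> k kn; rewrite sqr_sqrtr ?ltW//.
  have := bal k; rewrite (minn_idPl kn) => H.
  apply: (mulfI (lt0r_neq0 l0)); rewrite H /load; field.
  by rewrite !gt_eqF.
- move=> k kn; rewrite sqr_sqrtr ?ltW//.
  have := bal k; rewrite (minn_idPr (leqW kn)) => H.
  have mn : 0 < mu * n%:R by rewrite mulr_gt0// ltr0n.
  apply: (mulfI (lt0r_neq0 mn)); rewrite -H /load; field.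
  by rewrite (gt_eqF m0) pnatr_eq0 -lt0n n0.
- have cv : pi \o (fun k => `I_k) @ \oo --> pi (\bigcup_k `I_k).
    apply: nondecreasing_cvg_mu => //.
    by move=> i j ij; apply/subsetPset => x /= /leq_trans; exact.
  have UT : \bigcup_k `I_k = [set: nat] by apply/seteqP; split => // x _; exists x.+1 => /=.
  rewrite UT probability_setT in cv.
  have -> : partial (fun k => fine (pi [set k])) = fine \o (pi \o (fun k => `I_k)).
    by apply/funext => k; rewrite -partial_fine.
  exact: fine_cvg cv.
Qed.

Lemma diffusion_law_density (beta S kp : R) (nu : probability R R) :
  0 < beta -> 0 < S -> 0 < kp ->
  (forall A : set R, measurable A ->
    nu A = (\int[lebesgue_measure]_(x in A) (dens S beta kp x)%:E)%E) ->
  diffusion_law beta S kp (fun x => fine (nu [set` `]-oo, x[])).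
Proof.
move=> b0 S0 kp0 nuE.
have fin A : measurable A -> nu A \is a fin_num by move=> mA; exact: fin_num_measure.
have split_at (a b : R) : a <= b ->
    fine (nu [set` `]-oo, b[]) - fine (nu [set` `]-oo, a[]) = fine (nu [set` `[a, b[]).
  move=> ab; have -> : [set` `]-oo, b[] = [set` `]-oo, a[] `|` [set` `[a, b[].
    apply/seteqP; split => x /=; rewrite !in_itv/=.
      by case: (ltP x a) => xa xb; [left|right].
    by case=> [xa|/andP[]//]; exact: lt_le_trans ab.
  rewrite measureU//; first by rewrite fineD ?fin// addrC addKr.
  apply/seteqP; split => // x /= []; rewrite !in_itv/= => xa /andP[ax _].
  by rewrite ltNge ax in xa.
split.
- move=> x; rewrite fine_ge0//= -lee_fin fineK ?fin//.
  exact: probability_le1.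
- move=> a b m ab hm; rewrite split_at//.
  have mM x : a <= x <= b -> m <= dens S beta kp x <= 2 * kp.
    by move=> hx; rewrite hm// dens_le.
  by have /andP[] := prob_itv_bounds S0 b0 nuE ab mM.
- move=> a b m ab hm; rewrite split_at//.
  have mM x : a <= x <= b -> 0 <= dens S beta kp x <= m.
    by move=> hx; rewrite hm// dens_ge0.
  by have /andP[] := prob_itv_bounds S0 b0 nuE ab mM.
- exact: prob_lower_tail.
- move=> z bz; rewrite -(prob_upper_tail S0 b0 kp0 nuE bz).
  have -> : [set` `]-oo, z[] = ~` [set` `[z, +oo[].
    by apply/seteqP; split => x /=; rewrite !in_itv/= andbT ltNge => /negP.
  by rewrite probability_setC// fineB ?fin// /= opprB addrC subrK.
Qed.

(** Cells are closed on the right here and on the left in [lattice_cell_left]. A lattice point equal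
    to the threshold then counts for the event in either tail, and [partial q k.+1] is exact. *)
Lemma lattice_cell (S z : R) : 0 < S -> - S < z ->
  exists k, lattice S k < z <= lattice S k.+1.
Proof.
move=> S0 Sz.
have ex : exists k, z <= lattice S k.
  exists (Num.truncn (S * (z + S))).+1.
  have := truncnS_gt (S * (z + S)); rewrite /lattice => h.
  by rewrite lerBrDr ler_pdivlMr// mulrC ltW.
case: (ex_minnP ex) => -[|k] zk km; last first.
  exists k; rewrite zk andbT ltNge; apply/negP => /km; by rewrite ltnn.
by exfalso; move: zk; rewrite /lattice mul0r sub0r leNgt Sz.
Qed.

Lemma lattice_cell_left (S z : R) : 0 < S -> - S <= z ->
  exists k, lattice S k <= z < lattice S k.+1.
Proof.
move=> S0 Sz; exists (Num.truncn (S * (z + S))).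
have u0 : 0 <= S * (z + S) by rewrite mulr_ge0 ?(ltW S0)// -(opprK S) subr_ge0.
have /andP[h1 h2] := truncn_itv u0.
rewrite /lattice lerBlDr ltrBrDr ler_pdivrMr// ltr_pdivlMr//.
by rewrite !(mulrC _ S) h1.
Qed.

End Models.

Theorem theorem3 (R : realType) (beta : R) (hbeta : 0 < beta) :
  exists c1 C : R, [/\ 0 < c1, 0 < C &
  forall (lambda mu : R) (n : nat),
    0 < lambda -> 0 < mu -> (0 < n)%N ->
    n%:R = load lambda mu + beta * Num.sqrt (load lambda mu) ->
  forall (p : R -> R.-pker nat ~> nat) (pi : probability nat R),
    erlangC_chain lambda mu n p -> stationary p pi ->
  forall (d : measure_display) (T : measurableType d) (P : probability T R)
    (W : {RV P >-> R}),
    (forall A : set R, measurable A ->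
       distribution P W A = pushforward pi (scaled_state lambda mu) A) ->
  forall (d' : measure_display) (T' : measurableType d') (P' : probability T' R)
    (Y1 : {RV P' >-> R}) (kappa : R),
    0 < kappa -> has_density Y1 (Y1_density lambda mu beta kappa) ->
  (forall z : R, 0 < z -> z <= c1 * load lambda mu ->
     `| fine (P' [set w | z <= Y1 w]) / fine (P [set w | z <= W w]) - 1 |
       <= C / Num.sqrt (load lambda mu) * (1 + z / Num.sqrt (load lambda mu)))
  /\
  (forall z : R, 0 < z ->
     z <= Num.min (c1 * load lambda mu `^ 4^-1) (load lambda mu `^ 2^-1) ->
     `| fine (P' [set w | Y1 w <= - z]) / fine (P [set w | W w <= - z]) - 1 |
       <= C / Num.sqrt (load lambda mu)
            * (1 + z + z ^+ 4 / Num.sqrt (load lambda mu)))].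
Proof.
have [K1 K10 near] := upper_tail_near hbeta.
have [K2 K20 far] := upper_tail_far hbeta.
have [c [K3 [c0 K30 low]]] := lower_tail hbeta.
(* The bound 1 gives [z <= S ^+ 2] for the upper tail; the bound [Num.sqrt c] gives
   [z ^+ 2 <= c * S] for the lower one. *)
pose c1 := Num.min 1 (Num.sqrt c).
have c10 : 0 < c1 by rewrite lt_min ltr01 sqrtr_gt0.
have c1c : c1 ^+ 2 <= c.
  rewrite -[leRHS]sqr_sqrtr ?(ltW c0)//; apply: lerXn2r; rewrite ?nnegrE ?sqrtr_ge0 ?(ltW c10)//.
  by rewrite ge_min lexx orbT.
have c11 : c1 <= 1 by rewrite ge_min lexx.
exists c1, (K1 + K2 + K3); split=> //; first by rewrite !addr_gt0.
move=> lambda mu n l0 m0 n0 nE p pi ch st d T P W WE d' T' P' Y1 kappa kap0 Y1E.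
have ld0 : 0 < load lambda mu by rewrite divr_gt0.
set S := Num.sqrt (load lambda mu) in nE *.
have S0 : 0 < S by rewrite sqrtr_gt0.
have S2 : load lambda mu = S ^+ 2 by rewrite sqr_sqrtr// ltW.
have kp0 : 0 < kappa / mu by rewrite divr_gt0.
have r : regime beta S n by split=> //; rewrite nE S2.
set q := fun k => fine (pi [set k]).
have lq : queue_law S n q by exact: queue_law_stationary l0 m0 n0 ch st.
pose nu : probability R R :=
  [the probability R R of distribution P' Y1].
have nuE (A : set R) : measurable A ->
    nu A = (\int[lebesgue_measure]_(x in A) (dens S beta (kappa / mu) x)%:E)%E.
  move=> mA; transitivity (distribution P' Y1 A) => //.
  rewrite (Y1E A mA); apply: eq_integral => x _.
  by rewrite Y1_densityE.
have lY := diffusion_law_density hbeta S0 kp0 nuE.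
set Y := fun x => _ in lY.
have md : model beta S n (kappa / mu) q Y by split.
have WP (A : set R) k : measurable A -> scaled_state lambda mu @^-1` A = `I_k ->
    fine (P (W @^-1` A)) = partial q k.
  by move=> mA Ak; rewrite -partial_fine -Ak; congr fine; exact: WE.
have sE k : scaled_state lambda mu k = lattice S k by exact: scaled_stateE.
split=> z z0 zle.
  have [k /andP[kz zk]] : exists k, lattice S k < z <= lattice S k.+1.
    by apply: lattice_cell => //; apply: lt_trans z0; rewrite oppr_lt0.
  have zS : z <= S ^+ 2.
    by apply: le_trans zle _; rewrite S2 ler_piMl ?sqr_ge0.
  have YE : fine (P' [set w | z <= Y1 w]) = 1 - Y z.
    rewrite /Y; have -> : [set` `]-oo, z[] = ~` [set` `[z, +oo[].
      by apply/seteqP; split => x /=; rewrite !in_itv/= andbT ltNge => /negP.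
    rewrite probability_setC// fineB ?fin_num_measure//= opprB addrC subrK.
    congr (fine (P' _)); apply/seteqP; split => w /=; by rewrite in_itv/= andbT.
  have PE : fine (P [set w | z <= W w]) = 1 - partial q k.+1.
    have -> : [set w | z <= W w] = ~` (W @^-1` [set` `]-oo, z[]).
      by apply/seteqP; split => w /=; rewrite in_itv/= leNgt => /negP.
    have mW : measurable (W @^-1` [set` `]-oo, z[]).
      by rewrite -[X in measurable X]setTI; exact: measurable_funPT.
    rewrite probability_setC// fineB ?fin_num_measure//=; congr (1 - _).
    apply: WP => //; apply/seteqP; split => j /=; rewrite in_itv/= sE.
      move=> jz; rewrite ltnNge; apply/negP => /(lattice_mono S0) h.
      by have := lt_le_trans jz (le_trans zk h); rewrite ltxx.
    by move=> jk; apply: le_lt_trans kz; exact: lattice_mono.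
  rewrite YE PE.
  have zS0 : 0 <= z / S by rewrite divr_ge0// ltW.
  case: (leP z beta) => zb.
    apply: le_trans (near _ _ _ _ _ _ _ md zb kz zk) _.
    apply: (@le_trans _ _ ((K1 + K2 + K3) / S)).
      by rewrite ler_pM2r ?invr_gt0// -addrA lerDl addr_ge0// ltW.
    by rewrite ler_peMr ?lerDl// divr_ge0 ?ltW// !addr_gt0.
  apply: le_trans (far _ _ _ _ _ _ _ md zb zS kz zk) _.
  rewrite ler_wpM2r ?addr_ge0// ler_pM2r ?invr_gt0//.
  by rewrite addrAC addrC lerDl addr_ge0// ltW.
move: zle; rewrite le_min => /andP[z1 z2].
(* Keeps [- z] at or above the lowest lattice point [- S], so that some cell contains it. *)
have zS : z <= S by move: z2; rewrite powR12_sqrt// ltW.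
have zc : z ^+ 2 <= c * S.
  apply: (@le_trans _ _ ((c1 * load lambda mu `^ 4^-1) ^+ 2)).
    apply: lerXn2r; rewrite ?nnegrE ?(ltW z0)//.
    by rewrite mulr_ge0 ?powR_ge0// ltW.
  rewrite exprMn -[(_ `^ _) ^+ 2]powR_mulrn ?powR_ge0// -powRrM.
  have -> : 4^-1 * 2%:R = 2^-1 :> R by field.
  by rewrite powR12_sqrt ?(ltW ld0)// ler_pM2r.
have [k /andP[kz zk]] : exists k, lattice S k <= - z < lattice S k.+1.
  by apply: lattice_cell_left => //; rewrite lerN2.
have PE : fine (P [set w | W w <= - z]) = partial q k.+1.
  have -> : [set w | W w <= - z] = W @^-1` [set` `]-oo, (- z)]].
    by apply/seteqP; split => w /=; rewrite in_itv.
  apply: WP => //; apply/seteqP; split => j /=; rewrite in_itv/= sE.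
    move=> jz; rewrite ltnNge; apply/negP => /(lattice_mono S0) h.
    by have := lt_le_trans zk (le_trans h jz); rewrite ltxx.
  by move=> jk; apply: le_trans kz; exact: lattice_mono.
rewrite PE; apply: le_trans (low _ _ _ _ _ z _ _ md z0 zc kz (ltW zk) _) _.
  have -> : P' [set w | Y1 w <= - z] = nu [set` `]-oo, (- z)]].
    by rewrite /nu /=; congr (P' _); apply/seteqP; split => w /=; rewrite in_itv.
  rewrite /Y !fine_le ?fin_num_measure//; apply: le_measure; rewrite ?inE// => x /=;
    rewrite !in_itv/=.
    by move=> /le_lt_trans; apply.
  by move=> /ltW /le_trans; apply.
rewrite ler_wpM2r//.
  apply: addr_ge0; first by rewrite addr_ge0// ltW.
  by rewrite divr_ge0 ?exprn_ge0 ?(ltW z0) ?(ltW S0).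
by rewrite ler_pM2r ?invr_gt0// lerDr addr_ge0// ltW.
Qed.
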